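(* Let $\psi\in C^\infty([0,\infty);\mathbb{R})$ with $\psi(0)=0$ be such that $u=\Upsilon(\psi)\in C^\infty(\mathbb{R}^4;S^4)$ is a non-constant (equivariant) biharmonic map. Then, up to dilation, $\psi(r)=\pm2\arctan r$; that is, there exist $\lambda>0$ and a sign $\epsilon\in\{+1,-1\}$ such that $\psi(r)=2\epsilon\arctan(\lambda r)$ for all $r\ge0$.
   Context: $S^4=\{y\in\mathbb{R}^5:|y|=1\}$. For $\psi:[0,\infty)\to\mathbb{R}$ with $\psi(0)=0$, the map $\Upsilon(\psi):\mathbb{R}^4\to S^4$ is defined by $\Upsilon(\psi)(x)=\left(\frac{x}{|x|}\sin\psi(|x|),\cos\psi(|x|)\right)$ for $x\neq0$ and $\Upsilon(\psi)(0)=\hat e_5=(0,0,0,0,1)$. A smooth map $u:\mathbb{R}^4\to S^4$ is (extrinsically) biharmonic if $\Delta^2u(x)\perp T_{u(x)}S^4$ for all $x\in\mathbb{R}^4$, with $\Delta$ the componentwise Laplacian of the $\mathbb{R}^5$-valued map $u$. A dilation is a transformation $u\mapsto(x\mapsto u(\lambda x))$ with $\lambda>0$. *)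

(* Defs.v *)
From mathcomp Require Import all_boot all_order all_algebra.
From mathcomp Require Import all_classical all_reals all_analysis.
Import Order.TTheory GRing.Theory Num.Theory.
Import numFieldNormedType.Exports.

Set Implicit Arguments.
Unset Strict Implicit.
Unset Printing Implicit Defensive.

Local Open Scope classical_set_scope.
Local Open Scope ring_scope.

Section Euclidean.
Context {R : realType} {n : nat}.

Definition dot (u v : 'rV[R]_n) : R := \sum_(i < n) u 0 i * v 0 i.

(* The library norm `|x| on row vectors is the sup norm, hence this one. *)
Definition enorm (x : 'rV[R]_n) : R := Num.sqrt (dot x x).

Definition unit_sphere : set 'rV[R]_n := [set y | enorm y = 1].

Definition tangent_sphere (y : 'rV[R]_n) : set 'rV[R]_n := [set v | dot v y = 0].

End Euclidean.

Section HalfLine.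
Context {R : realType}.

Definition half_line : set R := [set r | 0 <= r].

(* The filter excludes negative arguments, so that this is the one-sided
   derivative at 0, and f only matters on the half-line. *)
Definition half_line_quotient (f : R -> R) (r : R) : set_system R :=
  (f s - f r) / (s - r) @[s --> within half_line r^'].

Definition half_line_derive (f : R -> R) (r : R) : R :=
  lim (half_line_quotient f r).

Definition smooth_half_line (f : R -> R) : Prop :=
  forall k r, 0 <= r -> cvg (half_line_quotient (iter k half_line_derive f) r).

End HalfLine.

Section Smooth.
Context {R : realType} {m n : nat}.

Definition basis_vec (i : 'I_m) : 'rV[R]_m := delta_mx 0 i.

Definition partial (i : 'I_m) (f : 'rV[R]_m -> R) : 'rV[R]_m -> R :=
  'D_(basis_vec i) f.

Definition iter_partial (s : seq 'I_m) (f : 'rV[R]_m -> R) : 'rV[R]_m -> R :=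
  foldr partial f s.

Definition smooth (f : 'rV[R]_m -> R) : Prop :=
  forall s : seq 'I_m, continuous (iter_partial s f) /\
    forall i x, derivable (iter_partial s f) x (basis_vec i).

Definition component (u : 'rV[R]_m -> 'rV[R]_n) (j : 'I_n) : 'rV[R]_m -> R :=
  fun x => u x 0 j.

Definition smooth_map (u : 'rV[R]_m -> 'rV[R]_n) : Prop :=
  forall j, smooth (component u j).

Definition laplacian (f : 'rV[R]_m -> R) (x : 'rV[R]_m) : R :=
  \sum_(i < m) partial i (partial i f) x.

Definition laplacian_map (u : 'rV[R]_m -> 'rV[R]_n) (x : 'rV[R]_m) : 'rV[R]_n :=
  \row_j laplacian (component u j) x.

(* A smooth map into the sphere is a smooth R^n-valued map with values in it. *)
Definition smooth_to_sphere (u : 'rV[R]_m -> 'rV[R]_n) : Prop :=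
  smooth_map u /\ forall x, unit_sphere (u x).

Definition biharmonic (u : 'rV[R]_m -> 'rV[R]_n) : Prop :=
  smooth_to_sphere u /\
  forall x v, tangent_sphere (u x) v ->
    dot (laplacian_map (laplacian_map u) x) v = 0.

End Smooth.

Definition Upsilon {R : realType} (psi : R -> R) (x : 'rV[R]_4) : 'rV[R]_5 :=
  if x == 0 then delta_mx 0 ord_max
  else row_mx (sin (psi (enorm x)) *: ((enorm x)^-1 *: x))
              (const_mx (cos (psi (enorm x))) : 'rV[R]_1).

(* Main.v *)
Require Import Defs.
From mathcomp Require Import all_boot all_order all_algebra.
From mathcomp Require Import all_classical all_reals all_analysis.
From mathcomp Require Import ring lra.
Import Order.TTheory GRing.Theory Num.Theory.
Import numFieldNormedType.Exports.
Local Open Scope ring_scope.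

(* In the variable t = ln r the function y(t) = psi(e^t) solves an autonomous
   fourth order equation, the Euler-Lagrange equation of
   y''^2 + y'^4 + y'^2 (10 - 6 sin^2 y) + 9 sin^2 y, and smoothness at r = 0 makes
   y and its derivatives decay like e^t at -oo, so the conserved Hamiltonian is 0.
   Put q = y' - sin y, M = y'' - sin y cos y and N = y'^2 - sin^2 y. Then
     q' = M - cos y q,  N' = 2 y' M,
     M'' = (6 y'^2 + 9 - 4 sin^2 y) M + 4 sin y cos y N,
     2 y' M' = M^2 + 2 sin y cos y M + N (8 + 3 y'^2 + sin^2 y).
   By the maximum principle M is identically 0 or has a constant sign near -oo.
   If M = 0 there, then q = 0 everywhere, that is y' = sin y and y = 2 atan (l e^t).
   Otherwise let M > 0, up to y -> -y; then q > 0. If y >= 0 somewhere near -oo, then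
   y', M, N > 0 from there on and y blows up in finite time. If y < 0 near -oo,
   then -y first increases; the Riccati equation for (y'' + 3 sin y) / y' forces it to
   turn around before reaching pi and to come back to 0, where it has entered the
   regime of finite-time blow-up. *)

Set Implicit Arguments.
Unset Strict Implicit.
Unset Printing Implicit Defensive.

(** * Derivatives of real functions *)

Section Calculus.
Local Open Scope classical_set_scope.
Local Open Scope ring_scope.
Context {R : realType}.
Implicit Types (f g : R -> R) (a b t l m : R).

Lemma der_eq f t l m : is_derive t 1 f l -> l = m -> is_derive t 1 f m.
Proof. by move=> fl <-. Qed.

Lemma der_const a t : is_derive t 1 (fun _ => a) 0.
Proof. exact: is_derive_cst. Qed.

Lemma der_id t : is_derive t 1 (fun x : R => x) 1.
Proof. exact: is_derive_id. Qed.

Lemma der_add f g t l m : is_derive t 1 f l -> is_derive t 1 g m ->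
  is_derive t 1 (fun x => f x + g x) (l + m).
Proof. by move=> fl gm; exact: is_deriveD. Qed.

Lemma der_opp f t l : is_derive t 1 f l -> is_derive t 1 (fun x => - f x) (- l).
Proof. by move=> fl; exact: is_deriveN. Qed.

Lemma der_mul f g t l m : is_derive t 1 f l -> is_derive t 1 g m ->
  is_derive t 1 (fun x => f x * g x) (l * g t + f t * m).
Proof.
move=> fl gm; apply: (der_eq (is_deriveM fl gm)).
by rewrite /GRing.scale /=; ring.
Qed.

Lemma der_comp f g t l m : is_derive (g t) 1 f l -> is_derive t 1 g m ->
  is_derive t 1 (fun x => f (g x)) (l * m).
Proof. by move=> fl gm; exact: (is_derive1_comp (f := f) (g := g)). Qed.

Lemma der_pow f n t l : is_derive t 1 f l ->
  is_derive t 1 (fun x => f x ^+ n) (n%:R * f t ^+ n.-1 * l).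
Proof.
move=> fl; elim: n => [|n IH].
  by rewrite mul0r mul0r; under eq_fun do rewrite expr0; exact: der_const.
under eq_fun do rewrite exprS.
apply: (der_eq (der_mul fl IH)).
case: n {IH} => [|n] /=; first by rewrite expr0; ring.
by rewrite !exprS -[n.+2%:R]natr1 -[n.+1%:R]natr1; ring.
Qed.

Lemma der_exp f t l : is_derive t 1 f l ->
  is_derive t 1 (fun x => expR (f x)) (expR (f t) * l).
Proof. by move=> fl; apply: der_comp; exact: is_derive_expR. Qed.

Lemma der_sin f t l : is_derive t 1 f l ->
  is_derive t 1 (fun x => sin (f x)) (cos (f t) * l).
Proof. by move=> fl; apply: der_comp; exact: is_derive_sin. Qed.

Lemma der_cos f t l : is_derive t 1 f l ->
  is_derive t 1 (fun x => cos (f x)) (- sin (f t) * l).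
Proof. by move=> fl; apply: der_comp; exact: is_derive_cos. Qed.

Lemma der_cont f t l : is_derive t 1 f l -> {for t, continuous f}.
Proof. by move=> [fl _]; apply/differentiable_continuous/derivable1_diffP. Qed.

Lemma der_within f (df : R -> R) a b :
  (forall t, a <= t <= b -> is_derive t 1 f (df t)) ->
  {within `[a, b], continuous f}.
Proof.
move=> fd; apply: derivable_within_continuous => x.
by rewrite in_itv /= => /fd [].
Qed.

Lemma der_ge0_le f (df : R -> R) a b : a <= b ->
  (forall t, a <= t <= b -> is_derive t 1 f (df t)) ->
  (forall t, a <= t <= b -> 0 <= df t) -> f a <= f b.
Proof.
move=> ab fd df0.
have [x xab|c] := @MVT_segment R f df a b ab _ (der_within fd).
  by apply: fd; move: xab; rewrite in_itv /= => /andP[/ltW -> /ltW ->].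
rewrite in_itv /= => cab E.
by rewrite -subr_ge0 E mulr_ge0 ?subr_ge0 ?df0.
Qed.

Lemma der_le0_ge f (df : R -> R) a b : a <= b ->
  (forall t, a <= t <= b -> is_derive t 1 f (df t)) ->
  (forall t, a <= t <= b -> df t <= 0) -> f b <= f a.
Proof.
move=> ab fd df0; rewrite -lerN2.
apply: (@der_ge0_le (fun x => - f x) (fun x => - df x)) => // t tab.
  by apply: der_opp; exact: fd.
by rewrite oppr_ge0 df0.
Qed.

Lemma der_gt0_lt f (df : R -> R) a b : a < b ->
  (forall t, a <= t <= b -> is_derive t 1 f (df t)) ->
  (forall t, a <= t <= b -> 0 < df t) -> f a < f b.
Proof.
move=> ab fd df0.
have [x xab|c] := @MVT_segment R f df a b (ltW ab) _ (der_within fd).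
  by apply: fd; move: xab; rewrite in_itv /= => /andP[/ltW -> /ltW ->].
rewrite in_itv /= => cab E.
by rewrite -subr_gt0 E mulr_gt0 ?subr_gt0 ?df0.
Qed.


Lemma cont_gt0 f t : {for t, continuous f} -> 0 < f t ->
  exists2 e, 0 < e & forall x, `|x - t| < e -> 0 < f x.
Proof.
move=> fc ft; have [e /= e0 fe] := proj1 (nbhs_ballP _ _) (cvgr_gt _ fc _ ft).
by exists e => // x xe; apply: fe; rewrite -ball_normE /= distrC.
Qed.

(** By Caratheodory's form of differentiability the difference quotient extends continuously to [t]
    with value [l > 0], so it is positive nearby. *)
Lemma der_sign f t l : is_derive t 1 f l -> 0 < l ->
  exists2 e, 0 < e & forall x, `|x - t| < e ->
    (t < x -> f t < f x) /\ (x < t -> f x < f t).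
Proof.
move=> /is_derive1_caratheodory [g [fg gc gt]] l0.
have [|e e0 ge] := cont_gt0 gc; first by rewrite gt.
exists e => // x /ge gx; split=> xt; rewrite -subr_gt0.
  by rewrite fg mulr_gt0 // subr_gt0.
by rewrite -opprB fg -mulrN opprB mulr_gt0 // subr_gt0.
Qed.

(** A positive derivative would give values below [f t] just to the left of [t]. The trapping
    arguments below use this at the time where a positive quantity first vanishes. *)
Lemma first_zero_der_le0 f t l a : a < t -> is_derive t 1 f l ->
  (forall x, a <= x < t -> f t <= f x) -> l <= 0.
Proof.
move=> ab fl fge; rewrite leNgt; apply/negP => l0.
have [e e0 fe] := der_sign fl l0.
pose x := Num.max a (t - e / 2).
have xt : x < t by rewrite gt_max ab /= ltrBlDr ltrDl divr_gt0.
have xe : `|x - t| < e.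
  rewrite ltr0_norm ?subr_lt0 // opprB ltrBlDr -ltrBlDl lt_max; apply/orP; right.
  by lra.
have [_ /(_ xt)] := fe x xe.
by rewrite ltNge fge // xt andbT le_max lexx.
Qed.

(** [T] is the infimum of the points of [[a, b]] where [f <= 0]; continuity excludes both signs of
    [f T]. *)
Lemma first_zero f a b : a <= b -> (forall t, a <= t -> {for t, continuous f}) ->
  0 < f a -> f b <= 0 ->
  exists T, [/\ a < T, T <= b, f T = 0 & forall t, a <= t < T -> 0 < f t].
Proof.
move=> ab fc fa fb.
pose S := [set t | a <= t <= b /\ f t <= 0].
have Sb : S b by rewrite /S /= ab lexx.
have Slb : has_lbound S by exists a => t [/andP[]].
have Sinf : has_inf S by split => //; exists b.
pose T := inf S.
have aT : a <= T by apply: lb_le_inf; [exists b | move=> t [/andP[]]].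
have Tb : T <= b by apply: ge_inf.
have fpos t : a <= t < T -> 0 < f t.
  move=> /andP[at_ tT]; rewrite ltNge; apply/negP => ft.
  have : T <= t by apply: ge_inf => //; rewrite /S /= at_ (ltW (lt_le_trans tT Tb)).
  by rewrite leNgt tT.
have fT0 : f T <= 0.
  rewrite leNgt; apply/negP => fT.
  have [e e0 fe] := cont_gt0 (fc T aT) fT.
  have [x [/andP[ax xb] fx] xT] := inf_adherent e0 Sinf.
  have Tx : T <= x by apply: ge_inf => //; rewrite /S /= ax xb.
  have : 0 < f x by apply: fe; rewrite ger0_norm ?subr_ge0 // ltrBlDl.
  by rewrite ltNge fx.
have aT' : a < T.
  by rewrite lt_neqAle aT andbT; apply: contraTneq fa => ->; rewrite -leNgt.
exists T; split => //; apply/eqP; rewrite eq_le fT0 /= leNgt; apply/negP => fT.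
have [||e e0 fe] := @cont_gt0 (fun x => - f x) T.
- by apply: cvgN; apply: fc.
- by rewrite oppr_gt0.
pose x := Num.max a (T - e / 2).
have xt : x < T by rewrite gt_max aT' /= ltrBlDr ltrDl divr_gt0.
have xe : `|x - T| < e.
  rewrite ltr0_norm ?subr_lt0 // opprB ltrBlDr -ltrBlDl lt_max; apply/orP; right.
  by lra.
have := fe x xe; rewrite oppr_gt0 ltNge ltW //.
by apply: fpos; rewrite xt andbT le_max lexx.
Qed.

End Calculus.

Ltac der_step := first
  [ match goal with D : forall t, is_derive t _ _ _ |- _ =>
      notypeclasses refine (D _) end
  | notypeclasses refine (der_const _ _)
  | notypeclasses refine (der_id _)
  | notypeclasses refine (der_opp _)
  | notypeclasses refine (der_pow _ _)
  | notypeclasses refine (der_mul _ _)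
  | notypeclasses refine (der_add _ _)
  | notypeclasses refine (der_exp _)
  | notypeclasses refine (der_sin _)
  | notypeclasses refine (der_cos _) ].

(** Differentiates along the structure of the expression, with derivatives of unknown functions
    taken from the context, and leaves the equality between the value found and the value
    claimed. *)
Ltac der := notypeclasses refine (der_eq _ _); [solve [repeat der_step] | rewrite /=].

(** * Finite-time blow-up *)

Section ZeroEnergy.
Local Open Scope classical_set_scope.
Local Open Scope ring_scope.
Context {R : realType}.

(* First integral of [polar_ode] below. *)
Definition hamiltonian (y y1 y2 y3 : R) : R :=
  y2 ^+ 2 - 2 * y1 * y3 + 3 * y1 ^+ 4 + y1 ^+ 2 * (10 - 6 * sin y ^+ 2)
  - 9 * sin y ^+ 2.

(** The energy relation determines [y3] wherever [y1] is nonzero; this third-order relation drives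
    the blow-up and turning arguments. *)
Definition zero_energy (y y1 y2 y3 : R -> R) :=
  [/\ forall t : R, is_derive t 1 y (y1 t), forall t : R, is_derive t 1 y1 (y2 t),
      forall t : R, is_derive t 1 y2 (y3 t) &
      forall t, hamiltonian (y t) (y1 t) (y2 t) (y3 t) = 0].

Lemma zero_energyN y y1 y2 y3 : zero_energy y y1 y2 y3 ->
  zero_energy (fun t => - y t) (fun t => - y1 t) (fun t => - y2 t) (fun t => - y3 t).
Proof.
move=> [D0 D1 D2 H]; split=> t; try exact: der_opp.
by have := H t; rewrite /hamiltonian sinN => <-; ring.
Qed.

Lemma sin_cos_bound (x : R) : - (1 / 2) <= sin x * cos x <= 1 / 2.
Proof.
have := cos2Dsin2 x; set s := sin x; set c := cos x => E.
by apply/andP; split; have := sqr_ge0 (s + c); have := sqr_ge0 (s - c); nra.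
Qed.

Section Blowup.
Variables y y1 y2 y3 : R -> R.
Hypothesis Z : zero_energy y y1 y2 y3.
Variable t0 : R.
Hypothesis y1_gt0 : 0 < y1 t0.
Let N t := y1 t ^+ 2 - sin (y t) ^+ 2.
Let M t := y2 t - sin (y t) * cos (y t).
Hypotheses (N_gt0 : 0 < N t0) (M_gt0 : 0 < M t0).

(** The region [y1 > 0], [N > 0], [M > k * N] is invariant forward in time. In it
    [N * expR (- 2 * k * y)] does not decrease, so [y1 >= sigma * expR (k * y)], which forces
    blow-up in finite time. *)
Lemma blowup : False.
Proof.
have [D0 D1 D2 H] := Z.
(* The second bound gives [M t0 - k * N t0 >= M t0 / 2 > 0]; the bound [k <= 1] keeps [1 - k ^+ 2]
   nonnegative below. *)
pose k := Num.min 1 (M t0 / (2 * N t0)).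
have k0 : 0 < k by rewrite lt_min ltr01 divr_gt0 // mulr_gt0.
have k1 : k <= 1 by rewrite ge_min lexx.
pose X t := M t - k * N t.
have X0 : 0 < X t0.
  have : k <= M t0 / (2 * N t0) by rewrite ge_min lexx orbT.
  by rewrite ler_pdivlMr ?mulr_gt0 // /X; move: (M t0) (N t0) M_gt0 => m n ? ?; lra.
clearbody k.
have dN (t : R) : is_derive t 1 N (2 * y1 t * M t).
  by rewrite /N; der; rewrite /M; ring.
have dX (t : R) : is_derive t 1 X
    (y3 t - (1 - 2 * sin (y t) ^+ 2) * y1 t - k * (2 * y1 t * M t)).
  rewrite /X /M; der; rewrite /M; have E := cos2sin2 (y t); ring: E.
(* Positivity of the minimum is positivity of all three quantities, so [first_zero] finds the first
   time at which one of them vanishes. *)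
pose f t := Num.min (y1 t) (Num.min (N t) (X t)).
have fc (t : R) : {for t, continuous f}.
  apply: continuous_min; first exact: der_cont (D1 t).
  by apply: continuous_min; [exact: der_cont (dN t) | exact: der_cont (dX t)].
have fP t : (0 < f t) = [&& 0 < y1 t, 0 < N t & 0 < X t] by rewrite !lt_min.
(* At a first zero of [X] the energy identity gives
   [2 y1 X' = N (8 + 2 k sin y cos y + (1 - k^2) (sin^2 y + 3 y1^2)) > 0]. *)
have f_gt0 t : t0 <= t -> 0 < f t.
  move=> t0t; rewrite ltNge; apply/negP => ft.
  have [|T [t0T _ fT fpos]] := first_zero t0t (fun x _ => fc x) _ ft.
    by rewrite fP y1_gt0 N_gt0 X0.
  have f_ge0 x : t0 <= x <= T -> [&& 0 <= y1 x, 0 <= N x & 0 <= X x].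
    move=> /andP[tx]; rewrite le_eqVlt => /orP[/eqP->|xT].
      by rewrite -!le_min -/(f T) fT.
    by have := fpos x; rewrite tx xT fP => /(_ isT) /and3P[/ltW-> /ltW-> /ltW->].
  have NT : 0 < N T.
    apply: (lt_le_trans N_gt0); apply: (der_ge0_le (ltW t0T) (fun x _ => dN x)) => x xT.
    have /and3P[a b c] := f_ge0 x xT.
    by rewrite !mulr_ge0 // -[M x](subrK (k * N x)) addr_ge0 // mulr_ge0 // ltW.
  have /and3P[y1T _ XT] : [&& 0 <= y1 T, 0 <= N T & 0 <= X T].
    by apply: f_ge0; rewrite lexx ltW.
  have y1T' : 0 < y1 T.
    rewrite lt_neqAle y1T andbT; apply: contraTneq NT => y10.
    by rewrite /N -y10 -leNgt expr0n /= sub0r oppr_le0 sqr_ge0.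
  have XT0 : X T = 0.
    apply/eqP; rewrite eq_le XT andbT leNgt; apply/negP => XT1.
    by have := fP T; rewrite fT ltxx y1T' NT XT1.
  have := first_zero_der_le0 t0T (dX T); rewrite leNgt => /(_ _)/negP; apply.
    by move=> x xT; rewrite XT0 ltW //; have := fpos x xT; rewrite fP => /and3P[].
  rewrite -(pmulr_rgt0 _ (mulr_gt0 (ltr0n _ 2) y1T')).
  have HT := H T; move: HT XT0 NT.
  rewrite /hamiltonian /X /M /N => HT XT0 NT.
  have B : 0 < 8 + 2 * k * (sin (y T) * cos (y T))
     + (1 - k ^+ 2) * (sin (y T) ^+ 2 + 3 * y1 T ^+ 2).
    have /andP[sc1 sc2] := sin_cos_bound (y T).
    have : - (1 / 2) <= k * (sin (y T) * cos (y T)) by nra.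
    have : 0 <= (1 - k ^+ 2) * (sin (y T) ^+ 2 + 3 * y1 T ^+ 2).
      apply: mulr_ge0; first by nra.
      by apply: addr_ge0; rewrite ?sqr_ge0 // mulr_ge0 ?sqr_ge0.
    by move=> ? ?; lra.
  have := mulr_gt0 NT B; congr (0 < _).
  have -> : 2 * y1 T * (y3 T - (1 - 2 * sin (y T) ^+ 2) * y1 T -
       k * (2 * y1 T * (y2 T - sin (y T) * cos (y T)))) =
     (2 * y1 T * y3 T) - 2 * (1 - 2 * sin (y T) ^+ 2) * y1 T ^+ 2
     - 4 * k * y1 T ^+ 2 * (y2 T - sin (y T) * cos (y T)) by ring.
  have -> : 2 * y1 T * y3 T = y2 T ^+ 2 + 3 * y1 T ^+ 4 +
    y1 T ^+ 2 * (10 - 6 * sin (y T) ^+ 2) - 9 * sin (y T) ^+ 2 by lra.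
  have -> : y2 T = sin (y T) * cos (y T) + k * (y1 T ^+ 2 - sin (y T) ^+ 2) by lra.
  have C2 := cos2sin2 (y T).
  ring: C2.
have [P1 PN PX] : [/\ forall t, t0 <= t -> 0 < y1 t, forall t, t0 <= t -> 0 < N t
    & forall t, t0 <= t -> 0 < X t].
  by split=> t /f_gt0; rewrite fP => /and3P[].
(* [G] is nondecreasing, so [expR (- k * y)] decreases at least linearly. *)
pose G t := N t * expR (- (2 * k) * y t).
have dG (t : R) : is_derive t 1 G ((2 * y1 t * X t) * expR (- (2 * k) * y t)).
  by rewrite /G; der; rewrite /X /M; ring.
pose sigma := Num.sqrt (G t0).
have G0 : 0 < G t0 by rewrite mulr_gt0 ?expR_gt0 ?PN.
have sigma0 : 0 < sigma by rewrite sqrtr_gt0.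
have W t : t0 <= t -> sigma <= y1 t * expR (- k * y t).
  move=> t0t; rewrite -(ler_pXn2r (n := 2)) ?nnegrE ?(ltW sigma0) //; last first.
    by rewrite mulr_ge0 ?expR_ge0 // ltW // P1.
  rewrite sqr_sqrtr ?(ltW G0) //; apply: (@le_trans _ _ (G t)).
    apply: (der_ge0_le t0t (fun x _ => dG x)) => x /andP[t0x _].
    by rewrite !mulr_ge0 ?expR_ge0 // ltW // ?P1 ?PX.
  rewrite /G exprMn -expRM_natl.
  have -> : 2 * (- k * y t) = - (2 * k) * y t by ring.
  by rewrite ler_wpM2r ?expR_ge0 // /N lerBlDr lerDl sqr_ge0.
pose e0 := expR (- k * y t0).
(* The time at which the linear upper bound for [expR (- k * y)], of slope [- k * sigma], reaches
   zero. *)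
pose t1 := t0 + e0 / (k * sigma).
have ks0 : 0 < k * sigma by rewrite mulr_gt0.
have t01 : t0 <= t1 by rewrite lerDl divr_ge0 ?expR_ge0 // ltW.
have dE (t : R) : is_derive t 1 (fun x => expR (- k * y x) + (k * sigma) * x)
    (k * (sigma - y1 t * expR (- k * y t))).
  by der; ring.
have : expR (- k * y t1) + k * sigma * t1 <= e0 + k * sigma * t0.
  apply: (der_le0_ge t01 (fun x _ => dE x)) => x /andP[t0x _].
  by rewrite mulr_ge0_le0 ?(ltW k0) // subr_le0 W.
have -> : k * sigma * t1 = k * sigma * t0 + e0.
  by rewrite /t1 mulrDr mulrCA divff ?gt_eqF // mulr1.
by have := expR_gt0 (- k * y t1); move: (expR _) (e0) => a b ? ?; lra.
Qed.
End Blowup.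
End ZeroEnergy.

(** * Turning points *)

Section Turning.
Local Open Scope classical_set_scope.
Local Open Scope ring_scope.
Context {R : realType}.

(* [Y / y1], with [Y = y2 + 3 sin y], solves a Riccati equation; this is that
   equation multiplied by [2 y1 ^+ 2]. *)
Lemma riccati (y y1 y2 y3 : R) : hamiltonian y y1 y2 y3 = 0 ->
  2 * y1 * (y3 + 3 * cos y * y1) = (y2 + 3 * sin y) * (y2 - 3 * sin y)
    + y1 ^+ 2 * (3 * y1 ^+ 2 + (4 + 6 * cos y + 6 * cos y ^+ 2)).
Proof.
rewrite /hamiltonian => H.
have -> : 2 * y1 * (y3 + 3 * cos y * y1) = 2 * y1 * y3 + 6 * cos y * y1 ^+ 2 by ring.
have -> : 2 * y1 * y3 = y2 ^+ 2 + 3 * y1 ^+ 4 + y1 ^+ 2 * (10 - 6 * sin y ^+ 2)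
  - 9 * sin y ^+ 2 by lra.
have E := cos2sin2 y; ring: E.
Qed.

(** For [rho = (y2 + 3 sin y) / y1] the relation [riccati] reads [2 rho' = B - rho ^+ 2], where [B]
    is [3 y1 ^+ 2] plus this expression. When [y1 ^+ 2 < 1] the bounds give [1 < B < 25], so
    [rho = 1] and [rho = K] with [K >= 5] are barriers. *)
Lemma riccati_coef_bounds (x : R) :
  1 < 4 + 6 * cos x + 6 * cos x ^+ 2 <= 16.
Proof.
have := cos_le1 x; have := cos_geN1 x; move: (cos x) => c c1 c2.
by apply/andP; split; [have := sqr_ge0 (c + 1 / 2); nra | nra].
Qed.

Section Turning_point.
Variables y y1 y2 y3 : R -> R.
Hypothesis Z : zero_energy y y1 y2 y3.
Variable t1 : R.
Hypotheses (y_gt0 : 0 < y t1) (y_ltpi : y t1 < pi) (y1_gt0 : 0 < y1 t1).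
Hypothesis N_lt0 : y1 t1 ^+ 2 < sin (y t1) ^+ 2.
Hypothesis M_lt0 : y2 t1 < sin (y t1) * cos (y t1).
Hypothesis Q_gt0 : y1 t1 < y2 t1 + 3 * sin (y t1).

(** [N] and [M] have the opposite sign to those of the blow-up argument, so that they start
    positive. While [y1 > 0], [Q > 0] says that the Riccati quotient exceeds 1. *)
Let N t := sin (y t) ^+ 2 - y1 t ^+ 2.
Let M t := sin (y t) * cos (y t) - y2 t.
Let Q t := y2 t + 3 * sin (y t) - y1 t.

Let n0_gt0 : 0 < N t1. Proof. by rewrite subr_gt0. Qed.

Let dN (t : R) : is_derive t 1 N (2 * y1 t * M t).
Proof. have [D0 D1 D2 _] := Z; rewrite /N; der; rewrite /M; ring. Qed.

Let dM (t : R) : is_derive t 1 M ((1 - 2 * sin (y t) ^+ 2) * y1 t - y3 t).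
Proof.
have [D0 D1 D2 _] := Z; rewrite /M; der; have E := cos2sin2 (y t); ring: E.
Qed.

Let dQ (t : R) : is_derive t 1 Q (y3 t + 3 * cos (y t) * y1 t - y2 t).
Proof. have [D0 D1 D2 _] := Z; rewrite /Q; der; ring. Qed.

(* Since [s ^+ 2 >= N t1 > 0] on [[t1, T]], [y] cannot cross [pi]. *)
Let y_range T : (forall t, t1 <= t <= T -> 0 <= y1 t /\ N t1 <= N t) ->
  forall t, t1 <= t <= T -> [/\ 0 < y t, y t < pi & N t1 <= sin (y t)].
Proof.
have [D0 D1 D2 _] := Z => h.
have s2 t : t1 <= t <= T -> N t1 <= sin (y t) ^+ 2.
  by move=> /h[_]; rewrite /N => h1; have := sqr_ge0 (y1 t); move: h1; lra.
move=> t /andP[t1t tT].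
have yt : 0 < y t.
  apply: (lt_le_trans y_gt0); apply: (der_ge0_le t1t (fun x _ => D0 x)) => x.
  by move=> /andP[t1x xt]; have [] := h x; rewrite ?t1x ?(le_trans xt).
have ytpi : y t < pi.
  rewrite ltNge; apply/negP => ypi.
  have [|||x [t1x xt]] := @first_zero _ (fun x => pi - y x) t1 t t1t.
  - by move=> x _; apply: (@der_cont _ _ _ (0 - y1 x)); rewrite sub0r; der; ring.
  - by rewrite subr_gt0.
  - by rewrite subr_le0.
  move=> /eqP; rewrite subr_eq0 => /eqP yx _.
  have := s2 x; rewrite (ltW t1x) (le_trans xt tT) -yx sinpi expr0n /=.
  by move=> /(_ isT); rewrite leNgt n0_gt0.
split => //.
have s0 : 0 < sin (y t) by rewrite sin_gt0_pi // yt ytpi.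
apply: (le_trans (s2 t _)); first by rewrite t1t.
by rewrite expr2 ger_pMl // sin_le1.
Qed.

(** While [y1 > 0], the inequalities [M > 0] and [y1 < y2 + 3 sin y < K y1] reproduce themselves,
    and [sin y] stays bounded below. The upper inequality then brings [y1] to zero in finite time,
    where the Riccati relation fixes [y2]. *)
Lemma turning_point : exists T, [/\ 0 < y T, y T < pi, y1 T = 0,
  y2 T = - (3 * sin (y T)) & y3 T <= y2 T].
Proof.
have [D0 D1 D2 H] := Z.
(* Large enough for [P t1 > 0], and at least 5 so that [K ^+ 2] exceeds the Riccati coefficient. *)
pose K := 5 + (y2 t1 + 3 * sin (y t1)) / y1 t1.
have [K5 PK] : 5 <= K /\ y2 t1 + 3 * sin (y t1) < K * y1 t1.
  have Y0 : 0 < y2 t1 + 3 * sin (y t1) by exact: lt_trans Q_gt0.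
  split; first by rewrite lerDl divr_ge0 ?ltW.
  by rewrite /K [ltRHS]mulrDl divfK ?gt_eqF // ltrDr mulr_gt0.
clearbody K.
pose P t := K * y1 t - (y2 t + 3 * sin (y t)).
have dP (t : R) : is_derive t 1 P (K * y2 t - (y3 t + 3 * cos (y t) * y1 t)).
  by rewrite /P; der; ring.
pose f t := Num.min (y1 t) (Num.min (M t) (Num.min (Q t) (P t))).
have fc (t : R) : {for t, continuous f}.
  apply: continuous_min; first exact: der_cont (D1 t).
  apply: continuous_min; first exact: der_cont (dM t).
  by apply: continuous_min; [exact: der_cont (dQ t) | exact: der_cont (dP t)].
have fP t : (0 < f t) = [&& 0 < y1 t, 0 < M t, 0 < Q t & 0 < P t] by rewrite !lt_min.
have ft1 : 0 < f t1 by rewrite fP y1_gt0 !subr_gt0 M_lt0 Q_gt0 PK.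
have mono T : (forall t, t1 <= t <= T -> 0 <= y1 t /\ 0 <= M t) ->
    forall t, t1 <= t <= T -> 0 <= y1 t /\ N t1 <= N t.
  move=> h t /andP[t1t tT]; split; first by have [] := h t; rewrite ?t1t.
  apply: (der_ge0_le t1t (fun x _ => dN x)) => x /andP[t1x xt].
  have [|a b] := h x; first by rewrite t1x (le_trans xt).
  by rewrite !mulr_ge0.
have [fpos|/existsNP[b /not_implyP[t1b /negP]]] :=
    pselect (forall t, t1 <= t -> 0 < f t).
  (* If nothing ever vanished, [P > 0] and [sin y >= N t1] would give [y2 <= K * y1 - 3 * N t1];
     integrated up to [b], with [y < pi], this makes [y1 b] negative. *)
  exfalso.
  pose b := t1 + (y1 t1 + K * pi) / (3 * N t1).
  have K0 : 0 < K by lra.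
  have n30 : 0 < 3 * N t1 by rewrite mulr_gt0.
  have t1b : t1 <= b.
    by rewrite lerDl divr_ge0 ?(ltW n30) // addr_ge0 ?mulr_ge0 ?pi_ge0 // ltW.
  have rng t : t1 <= t -> [/\ 0 < y t, y t < pi & N t1 <= sin (y t)].
    move=> t1t; apply: (@y_range t); last by rewrite t1t lexx.
    apply: mono => x /andP[/fpos]; rewrite fP => /and4P[a c _ _] _.
    by split; apply: ltW.
  have dF (t : R) : is_derive t 1 (fun x => y1 x - K * y x + 3 * N t1 * x)
      (y2 t - K * y1 t + 3 * N t1) by der; ring.
  have : y1 b - K * y b + 3 * N t1 * b <= y1 t1 - K * y t1 + 3 * N t1 * t1.
    apply: (der_le0_ge t1b (fun x _ => dF x)) => x /andP[t1x _].
    have [_ _ sx] := rng x t1x; have := fpos x t1x.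
    rewrite fP => /and4P[_ _ _]; rewrite /P; move: (N t1) sx => n; lra.
  have -> : 3 * N t1 * b = 3 * N t1 * t1 + (y1 t1 + K * pi).
    by rewrite /b mulrDr mulrCA divff ?gt_eqF // mulr1.
  have [_ ybpi _] := rng b t1b; have := fpos b t1b; rewrite fP => /and4P[y1b _ _ _].
  have := mulr_gt0 K0 y_gt0; have : K * y b <= K * pi by rewrite ler_pM2l // ltW.
  by move: y1b; move: (N t1) (y1 b) (y1 t1) (y t1) (y b) => n b1 a1 a b0; lra.
rewrite -leNgt => fb.
have [T [t1T _ fT fpos]] := first_zero t1b (fun x _ => fc x) ft1 fb.
have f_ge0 x : t1 <= x <= T -> [&& 0 <= y1 x, 0 <= M x, 0 <= Q x & 0 <= P x].
  move=> /andP[tx]; rewrite le_eqVlt => /orP[/eqP->|xT].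
    by rewrite -!le_min -/(f T) fT.
  by have := fpos x; rewrite tx xT fP => /(_ isT) /and4P[/ltW-> /ltW-> /ltW-> /ltW->].
have y1M x : t1 <= x <= T -> 0 <= y1 x /\ 0 <= M x by move=> /f_ge0/and4P[].
have TT : t1 <= T <= T by rewrite lexx ltW.
have [yT yTpi sT] := y_range (mono _ y1M) TT.
have [_ NT] := mono _ y1M _ TT.
have /and4P[y1T MT QT PT] := f_ge0 T TT.
have riccT := riccati (H T).
have /andP[B1 B16] := riccati_coef_bounds (y T).
have NT0 := lt_le_trans n0_gt0 NT.
have NT' : y1 T ^+ 2 < sin (y T) ^+ 2 by rewrite -subr_gt0.
have s1 : sin (y T) ^+ 2 <= 1 by have := sqr_ge0 (cos (y T)); rewrite cos2sin2 subr_ge0.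
have {}B1 : 0 < (3 * y1 T ^+ 2 + (4 + 6 * cos (y T) + 6 * cos (y T) ^+ 2)) - 1.
  by have := sqr_ge0 (y1 T); lra.
have {}B16 : 0 < K ^+ 2 - (3 * y1 T ^+ 2 + (4 + 6 * cos (y T) + 6 * cos (y T) ^+ 2)).
  by have : 5 ^+ 2 <= K ^+ 2 by [rewrite ler_pXn2r // nnegrE; lra]; lra.
move: riccT B1 B16; set B := 3 * y1 T ^+ 2 + _ => riccT B1 B16.
(* If [y1 T > 0], none of [M], [Q], [P] can vanish at [T]: at a zero, [2 * y1 T] times the
   derivative is respectively [N * (8 + 3 y1 ^+ 2 + sin y ^+ 2)], [y1 ^+ 2 * (B - 1)] and
   [y1 ^+ 2 * (K ^+ 2 - B)], all positive. *)
have y1T0 : y1 T = 0.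
  apply/eqP; rewrite eq_le y1T andbT leNgt; apply/negP => y1T'.
  have y1T2 : 0 < 2 * y1 T by rewrite mulr_gt0.
  have y1T3 : 0 < y1 T ^+ 2 by rewrite exprn_gt0.
  have MT' : 0 < M T.
    rewrite lt_neqAle MT andbT; apply/eqP => /esym M0.
    have := first_zero_der_le0 t1T (dM T); rewrite leNgt => /(_ _)/negP; apply.
      by move=> x xT; rewrite M0; have := fpos x xT; rewrite fP => /and4P[_ /ltW].
    rewrite -(pmulr_rgt0 _ y1T2).
    have := H T; rewrite /hamiltonian => HT.
    have : 0 < N T * (8 + 3 * y1 T ^+ 2 + sin (y T) ^+ 2).
      by rewrite mulr_gt0 // -addrA ltr_wpDr // addr_ge0 ?sqr_ge0 // mulr_ge0 ?sqr_ge0.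
    congr (0 < _).
    have -> : 2 * y1 T * ((1 - 2 * sin (y T) ^+ 2) * y1 T - y3 T) =
      2 * y1 T ^+ 2 * (1 - 2 * sin (y T) ^+ 2) - 2 * y1 T * y3 T by ring.
    have -> : 2 * y1 T * y3 T = y2 T ^+ 2 + 3 * y1 T ^+ 4 +
      y1 T ^+ 2 * (10 - 6 * sin (y T) ^+ 2) - 9 * sin (y T) ^+ 2 by lra.
    have -> : y2 T = sin (y T) * cos (y T).
      by move/eqP: M0; rewrite subr_eq0 => /eqP.
    rewrite /N; have E := cos2sin2 (y T); ring: E.
  have QT' : 0 < Q T.
    rewrite lt_neqAle QT andbT; apply/eqP => /esym Q0.
    have := first_zero_der_le0 t1T (dQ T); rewrite leNgt => /(_ _)/negP; apply.
      by move=> x xT; rewrite Q0; have := fpos x xT; rewrite fP => /and4P[_ _ /ltW].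
    rewrite -(pmulr_rgt0 _ y1T2) mulrBr riccT.
    have -> : y2 T = y1 T - 3 * sin (y T) by move: Q0; rewrite /Q; lra.
    by have := mulr_gt0 y1T3 B1; congr (0 < _); ring.
  have PT' : 0 < P T.
    rewrite lt_neqAle PT andbT; apply/eqP => /esym P0.
    have := first_zero_der_le0 t1T (dP T); rewrite leNgt => /(_ _)/negP; apply.
      by move=> x xT; rewrite P0; have := fpos x xT; rewrite fP => /and4P[_ _ _ /ltW].
    rewrite -(pmulr_rgt0 _ y1T2) mulrBr riccT.
    have -> : y2 T = K * y1 T - 3 * sin (y T) by move: P0; rewrite /P; lra.
    by have := mulr_gt0 y1T3 B16; congr (0 < _); ring.
  by have := fP T; rewrite fT ltxx y1T' MT' QT' PT'.
(* At [y1 = 0] the Riccati relation leaves [y2 = 3 sin y] or [y2 = - 3 sin y], and [y2 <= 0] because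
   [y1] has come down to zero. *)
have y2T : y2 T = - (3 * sin (y T)).
  have s0 : 0 < sin (y T) by rewrite sin_gt0_pi // yT yTpi.
  have y2T : y2 T <= 0.
    apply: (first_zero_der_le0 t1T (D1 T)) => x xT; rewrite y1T0.
    by have := fpos x xT; rewrite fP => /and4P[/ltW].
  move: riccT; rewrite y1T0 mulr0 mul0r expr0n /= mul0r addr0 => /esym/eqP.
  by rewrite mulf_eq0 => /orP[]/eqP; lra.
exists T; split => //.
(* [Q] vanishes at [T] as well, so its derivative there, [y3 - y2], is nonpositive. *)
have Q0 : Q T = 0 by rewrite /Q y2T y1T0; ring.
have := first_zero_der_le0 t1T (dQ T).
rewrite y1T0 mulr0 addr0 subr_le0; apply => x xT.
by rewrite Q0; have := fpos x xT; rewrite fP => /and4P[_ _ /ltW].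
Qed.

(** After the turning point [y1 < 0] and [y2 + 3 sin y < 0], and both persist until [y] is back at
    0. At that time [y1] and [y2] are negative, so [- y] satisfies the hypotheses of [blowup]. *)
Lemma turning_absurd : False.
Proof.
have [D0 D1 D2 H] := Z.
have [T [yT yTpi y1T y2T y3T]] := turning_point.
have sT : 0 < sin (y T) by rewrite sin_gt0_pi // yT yTpi.
pose V t := - (y2 t + 3 * sin (y t)).
have dV (t : R) : is_derive t 1 V (- (y3 t + 3 * cos (y t) * y1 t)).
  by rewrite /V; der; ring.
(* At [T] both [- y1] and [V] vanish with derivative at least [3 sin (y T) > 0]; [t2] is slightly
   later. *)
have [t2 [y1t2 Vt2 yt2 yt2pi]] : exists t2, [/\ y1 t2 < 0, 0 < V t2, 0 < y t2 & y t2 < pi].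
  have [|e1 e10 he1] := @der_sign _ _ _ _ (der_opp (D1 T)); first by rewrite y2T; lra.
  have [|e2 e20 he2] := @der_sign _ _ _ _ (dV T); first by rewrite y1T; lra.
  have [e3 e30 he3] := cont_gt0 (der_cont (D0 T)) yT.
  have cpi : {for T, continuous (fun x => pi - y x)}.
    by apply: (@der_cont _ _ _ (0 - y1 T)); rewrite sub0r; der; ring.
  have [|e4 e40 he4] := cont_gt0 cpi; first by rewrite subr_gt0.
  pose e := Num.min (Num.min e1 e2) (Num.min e3 e4).
  have e0 : 0 < e by rewrite !lt_min e10 e20 e30 e40.
  have [t2T] : T < T + e / 2 /\ `|T + e / 2 - T| < e.
    by rewrite ltrDl divr_gt0 // addrAC subrr add0r gtr0_norm ?divr_gt0 //; split=> //; lra.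
  rewrite !lt_min => /andP[/andP[l1 l2] /andP[l3 l4]]; exists (T + e / 2); split.
  - by have [/(_ t2T)] := he1 _ l1; rewrite y1T oppr0 oppr_gt0.
  - by have [/(_ t2T)] := he2 _ l2; rewrite {1}/V y2T addNr oppr0.
  - exact: he3.
  - by rewrite -subr_gt0; exact: he4.
pose f t := Num.min (- y1 t) (Num.min (V t) (y t)).
have fc (t : R) : {for t, continuous f}.
  apply: continuous_min; first exact: der_cont (der_opp (D1 t)).
  by apply: continuous_min; [exact: der_cont (dV t) | exact: der_cont (D0 t)].
have fP t : (0 < f t) = [&& y1 t < 0, 0 < V t & 0 < y t] by rewrite !lt_min oppr_gt0.
have ft2 : 0 < f t2 by rewrite fP y1t2 Vt2 yt2.
have y1_le b : (forall x, t2 <= x <= b -> [&& y1 x <= 0, 0 <= V x & 0 <= y x]) ->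
    forall x, t2 <= x <= b -> y1 x <= y1 t2.
  move=> h x /andP[t2x xb].
  apply: (der_le0_ge t2x (fun z _ => D1 z)) => z /andP[t2z zx].
  have zb : t2 <= z <= b by rewrite t2z (le_trans zx).
  have /and3P[_ Vz yz] := h z zb.
  have ypi : y z <= pi.
    apply: le_trans (ltW yt2pi).
    apply: (der_le0_ge t2z (fun w _ => D0 w)) => w /andP[t2w wz].
    have wb : t2 <= w <= b by rewrite t2w (le_trans wz) // (le_trans zx).
    by have /and3P[] := h w wb.
  have : 0 <= sin (y z) by rewrite sin_ge0_pi // yz ypi.
  by move: Vz; rewrite /V; lra.
have [fpos|/existsNP[b /not_implyP[t2b /negP]]] :=
    pselect (forall t, t2 <= t -> 0 < f t).
  (* The line through [y t2] at [t2] with slope [y1 t2 < 0] bounds [y] from above and reaches zero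
     at [b]. *)
  pose b := t2 - y t2 / y1 t2.
  have t2b : t2 <= b.
    by rewrite lerDl oppr_ge0 mulr_ge0_le0 // ?invr_le0 ltW.
  have dF (t : R) : is_derive t 1 (fun x => y x - y1 t2 * x) (y1 t - y1 t2).
    by der; ring.
  have : y b - y1 t2 * b <= y t2 - y1 t2 * t2.
    apply: (der_le0_ge t2b (fun z _ => dF z)) => z /andP[t2z zb].
    rewrite subr_le0; apply: (y1_le b); last by rewrite t2z.
    move=> w /andP[/fpos]; rewrite fP => /and3P[a c d] _.
    by rewrite !ltW.
  have -> : y1 t2 * b = y1 t2 * t2 - y t2.
    by rewrite /b mulrBr mulrCA divff ?lt_eqF // mulr1.
  by have := fpos b t2b; rewrite fP => /and3P[_ _]; lra.
rewrite -leNgt => fb.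
have [U [t2U _ fU fpos]] := first_zero t2b (fun x _ => fc x) ft2 fb.
have f_ge0 x : t2 <= x <= U -> [&& y1 x <= 0, 0 <= V x & 0 <= y x].
  move=> /andP[tx]; rewrite le_eqVlt => /orP[/eqP->|xU].
    by rewrite -oppr_ge0 -!le_min -/(f U) fU.
  by have := fpos x; rewrite tx xU fP => /(_ isT) /and3P[/ltW-> /ltW-> /ltW->].
have UU : t2 <= U <= U by rewrite lexx ltW.
have y1U : y1 U < 0 := le_lt_trans (y1_le _ f_ge0 _ UU) y1t2.
have /and3P[_ VU yU] := f_ge0 U UU.
(* At a zero of [V] only the positive [y1 ^+ 2] term of [riccati] survives; dividing by
   [2 * y1 U < 0] gives [V' > 0], impossible at a first zero. *)
have VU' : 0 < V U.
  rewrite lt_neqAle VU andbT; apply/eqP => /esym V0.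
  have := first_zero_der_le0 t2U (dV U); rewrite leNgt => /(_ _)/negP; apply.
    by move=> x xU; rewrite V0; have := fpos x xU; rewrite fP => /and3P[_ /ltW].
  rewrite oppr_gt0 -(nmulr_rgt0 _ (_ : 2 * y1 U < 0)); last by rewrite nmulr_llt0.
  rewrite (riccati (H U)).
  have -> : y2 U + 3 * sin (y U) = 0 by move: V0; rewrite /V; lra.
  have /andP[B1 _] := riccati_coef_bounds (y U).
  rewrite mul0r add0r; have y1U2 : 0 < y1 U ^+ 2 by rewrite exprn_even_gt0 //= lt_eqF.
  by rewrite mulr_gt0 //; move: B1 y1U2; lra.
have yU0 : y U = 0.
  apply/eqP; rewrite eq_le yU andbT leNgt; apply/negP => yU'.
  by have := fP U; rewrite fU ltxx y1U VU' yU'.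
have s0 : sin (y U) = 0 by rewrite yU0 sin0.
apply: (blowup (zero_energyN Z) (t0 := U)); rewrite ?oppr_gt0 //.
  by rewrite sinN s0 oppr0 expr0n /= subr0 sqrrN exprn_even_gt0 //= ?lt_eqF.
by move: VU'; rewrite /V sinN s0; lra.
Qed.
End Turning_point.
End Turning.

(** * Behaviour at minus infinity *)

Section Ninfty.
Local Open Scope classical_set_scope.
Local Open Scope ring_scope.
Context {R : realType}.
Implicit Types (f df : R -> R) (t : R).

Lemma near_ninfty_ex (P : R -> Prop) :
  (\forall t \near -oo, P t) -> exists t0, forall t, t <= t0 -> P t.
Proof.
move=> [M [_ MP]]; exists (M - 1) => t tM; apply: MP.
by apply: le_lt_trans tM _; rewrite ltrBlDr ltrDl.
Qed.

Lemma expR_ninfty : expR t @[t --> -oo] --> (0 : R).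
Proof. by apply/cvgNy_compNP; exact: cvgr_expR. Qed.

Lemma ge0_of_ninfty f df t0 : f t @[t --> -oo] --> 0 ->
  (forall t, t <= t0 -> is_derive t 1 f (df t)) ->
  (forall t, t <= t0 -> 0 <= df t) -> forall t, t <= t0 -> 0 <= f t.
Proof.
move=> f0 fd df0 t tt0; rewrite leNgt; apply/negP => ft.
have [s0 hs] := near_ninfty_ex (cvgr_gt _ f0 _ ft).
pose s := Num.min s0 t.
have : f t < f s by apply: hs; rewrite ge_min lexx.
apply/negP; rewrite -leNgt; apply: (@der_ge0_le _ _ df).
- by rewrite ge_min lexx orbT.
- by move=> x /andP[_ xt]; apply: fd; exact: le_trans tt0.
- by move=> x /andP[_ xt]; apply: df0; exact: le_trans tt0.
Qed.

(** If [f t <= 0], then [f] is negative slightly to the left at [t2], and above [f t2] far out at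
    [s]. The minimum on [[s, t2]] is negative and not attained at [s], so the derivative there is
    nonpositive, a contradiction. *)
Lemma gt0_of_ninfty f df t0 : f t @[t --> -oo] --> 0 ->
  (forall t, t <= t0 -> is_derive t 1 f (df t)) ->
  (forall t, t <= t0 -> f t <= 0 -> 0 < df t) -> forall t, t <= t0 -> 0 < f t.
Proof.
move=> f0 fd df0 t tt0; rewrite ltNge; apply/negP => ft.
have [e e0 he] := der_sign (fd t tt0) (df0 t tt0 ft).
pose t2 := t - e / 2.
have t2t : t2 < t by rewrite ltrBlDr ltrDl divr_gt0.
have ft2 : f t2 < 0.
  apply: lt_le_trans ft; have [|_] := he t2; last exact.
  by rewrite ltr0_norm ?subr_lt0 // /t2; lra.
have [s0 hs] := near_ninfty_ex (cvgr_gt _ f0 _ ft2).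
pose s := Num.min s0 t2.
have sa : s <= t2 by rewrite ge_min lexx orbT.
have fs : f t2 < f s by apply: hs; rewrite ge_min lexx.
have [|c] := @EVT_min R f s t2 sa _.
  apply: (@der_within _ f df) => x /andP[_ xt2].
  by apply: fd; apply: le_trans tt0; exact: le_trans (ltW t2t).
rewrite in_itv /= => /andP[sc ct2] cmin.
have fc : f c <= f t2 by apply: cmin; rewrite in_itv /= sa lexx.
have sc' : s < c.
  by rewrite lt_neqAle sc andbT; apply: contraTneq fc => <-; rewrite -ltNge.
have ct0 : c <= t0 by apply: le_trans tt0; exact: le_trans (ltW t2t).
have := first_zero_der_le0 sc' (fd c ct0).
rewrite leNgt df0 //; last exact: le_trans (ltW ft2).
move=> /(_ _)/notF; apply => x /andP[sx xc]; apply: cmin.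
by rewrite in_itv /= sx (le_trans (ltW xc)).
Qed.

End Ninfty.

(** * The scalar equation y' = sin y *)

Section SinBounds.
Local Open Scope classical_set_scope.
Local Open Scope ring_scope.
Context {R : realType}.

Lemma subr_sin_homo (x y : R) : x <= y -> x - sin x <= y - sin y.
Proof.
have d (t : R) : is_derive t 1 (fun t => t - sin t) (1 - cos t) by der; ring.
move=> xy; apply: (der_ge0_le xy (fun t _ => d t)) => t _; by rewrite subr_ge0 cos_le1.
Qed.

Lemma addr_sin_homo (x y : R) : x <= y -> x + sin x <= y + sin y.
Proof.
have d (t : R) : is_derive t 1 (fun t => t + sin t) (1 + cos t) by der; ring.
move=> xy; apply: (der_ge0_le xy (fun t _ => d t)) => t _; by have := cos_geN1 t; lra.
Qed.

Lemma sin_lipschitz (x y : R) : (x - y) * (sin x - sin y) <= (x - y) ^+ 2 /\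
  - (x - y) ^+ 2 <= (x - y) * (sin x - sin y).
Proof.
have [xy|/ltW yx] := leP x y.
  by have := subr_sin_homo xy; have := addr_sin_homo xy; nra.
by have := subr_sin_homo yx; have := addr_sin_homo yx; nra.
Qed.

Lemma sin_le_id (x : R) : 0 <= x -> sin x <= x.
Proof. by move=> /subr_sin_homo; rewrite sin0; lra. Qed.

Lemma sin_double_atan (x : R) : sin (2 * atan x) = 2 * x / (1 + x ^+ 2).
Proof.
have c0 : cos (atan x) != 0.
  by rewrite gt_eqF // cos_gt0_pihalf // atan_gtNpi2 atan_ltpi2.
rewrite -[in RHS](atanK x) -(cos2_tan2 c0) invrK [in LHS]mulr_natl sin_mulr2n /tan.
by rewrite -mulr_natl; field.
Qed.

(* The flow of [y' = sin y] is explicit, by uniqueness for the scalar equation. *)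
Lemma sin_flow (y : R -> R) t1 : (forall t : R, is_derive t 1 y (sin (y t))) ->
  `|y t1| <= 1 -> exists l, forall t, y t = 2 * atan (l * expR t).
Proof.
(* This choice makes the explicit solution agree with [y] at [t1]; the bound on [y t1] puts
   [y t1 / 2] where [atan] inverts [tan]. *)
move=> dy yt1; exists (tan (y t1 / 2) * expR (- t1)).
set l := _ * _; pose w t := 2 * atan (l * expR t).
have dw (t : R) : is_derive t 1 w (sin (w t)).
  have da (x : R) : is_derive x 1 (fun t => atan (l * expR t))
      ((1 + (l * expR x) ^+ 2)^-1 * (l * expR x)).
    notypeclasses refine (der_eq (der_comp (f := atan) (is_derive1_atan _) _) _).
      by repeat der_step.
    by rewrite /=; ring.
  rewrite /w; der; rewrite sin_double_atan; field.
  by rewrite gt_eqF // ltr_pwDl // sqr_ge0.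
have w1 : w t1 = y t1.
  rewrite /w /l -mulrA -expRD addNr expR0 mulr1 tanK; first by field.
  have := pi_ge2 R; move: yt1; rewrite ler_norml in_itv /=; move: (pi : R) => p.
  by move=> /andP[? ?] ?; apply/andP; split; lra.
suff W t : (y t - w t) ^+ 2 <= 0.
  by move=> t; apply/eqP; rewrite -subr_eq0 -sqrf_eq0 eq_le W sqr_ge0.
(* As [sin] is 1-Lipschitz, the squared difference is nondecreasing after multiplication by
   [expR (2 * t)] and nonincreasing after multiplication by [expR (- 2 * t)]; it vanishes at
   [t1]. *)
have [tt1|/ltW t1t] := leP t t1.
  have dG (x : R) : is_derive x 1 (fun t => (y t - w t) ^+ 2 * expR (2 * t))
    (2 * ((y x - w x) ^+ 2 + (y x - w x) * (sin (y x) - sin (w x))) * expR (2 * x)).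
    by der; ring.
  have : (y t - w t) ^+ 2 * expR (2 * t) <= (y t1 - w t1) ^+ 2 * expR (2 * t1).
    apply: (der_ge0_le tt1 (fun x _ => dG x)) => x _.
    have [_ h] := sin_lipschitz (y x) (w x).
    by rewrite !mulr_ge0 ?expR_ge0 // -lerBlDl sub0r.
  by rewrite w1 subrr expr0n /= mul0r pmulr_lle0 ?expR_gt0.
have dG (x : R) : is_derive x 1 (fun t => (y t - w t) ^+ 2 * expR (- 2 * t))
    (2 * ((y x - w x) * (sin (y x) - sin (w x)) - (y x - w x) ^+ 2) * expR (- 2 * x)).
  by der; ring.
have : (y t - w t) ^+ 2 * expR (- 2 * t) <= (y t1 - w t1) ^+ 2 * expR (- 2 * t1).
  apply: (der_le0_ge t1t (fun x _ => dG x)) => x _.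
  have [h _] := sin_lipschitz (y x) (w x).
  by rewrite mulr_le0_ge0 ?expR_ge0 // mulr_ge0_le0 // subr_le0.
by rewrite w1 subrr expr0n /= mul0r pmulr_lle0 ?expR_gt0.
Qed.

End SinBounds.

(** * Entire solutions *)

Section Entire.
Local Open Scope classical_set_scope.
Local Open Scope ring_scope.
Context {R : realType}.

(* Tangential component of the biharmonic map equation in the variable [ln r]. *)
Definition polar_ode (y y1 y2 y4 : R) : Prop :=
  y4 = 6 * y1 ^+ 2 * y2 + (10 - 6 * sin y ^+ 2) * y2
       - 6 * y1 ^+ 2 * sin y * cos y - 9 * sin y * cos y.

Lemma cvg_exprn (f : R -> R) n (l : R) : f t @[t --> -oo] --> l ->
  f t ^+ n @[t --> -oo] --> l ^+ n.
Proof. by move=> fl; exact: (continuous_cvg _ (@exprn_continuous R n l) fl). Qed.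

Lemma cvg_mull (f : R -> R) (k l : R) : f t @[t --> -oo] --> l ->
  k * f t @[t --> -oo] --> k * l.
Proof. by move=> fl; apply: cvgM fl; exact: cvg_cst. Qed.

Lemma cvg0_of_expR f (a : R) :
  f t * expR (- t) @[t --> -oo] --> a -> f t @[t --> -oo] --> (0 : R).
Proof.
move=> fa; have := cvgM fa (@expR_ninfty R); rewrite mulr0 => h.
suff -> : f = (fun t => f t * expR (- t)) * expR by exact: h.
by apply/funext => t; rewrite /GRing.mul /= -mulrA -expRD addNr expR0 mulr1.
Qed.

(* The energy of [psi] is constant in [t = ln r] and vanishes at the origin. *)
Lemma zero_energy_of_ode (y y1 y2 y3 y4 : R -> R) :
  (forall t : R, is_derive t 1 y (y1 t)) -> (forall t : R, is_derive t 1 y1 (y2 t)) ->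
  (forall t : R, is_derive t 1 y2 (y3 t)) -> (forall t : R, is_derive t 1 y3 (y4 t)) ->
  (forall t, polar_ode (y t) (y1 t) (y2 t) (y4 t)) ->
  y t @[t --> -oo] --> (0 : R) -> y1 t @[t --> -oo] --> (0 : R) ->
  y2 t @[t --> -oo] --> (0 : R) -> y3 t @[t --> -oo] --> (0 : R) ->
  zero_energy y y1 y2 y3.
Proof.
move=> D0 D1 D2 D3 ode l0 l1 l2 l3; split => // t.
pose h x := hamiltonian (y x) (y1 x) (y2 x) (y3 x).
have dh (x : R) : is_derive x 1 h 0.
  rewrite /h /hamiltonian; der; rewrite (ode x); ring.
have hlim : h x @[x --> -oo] --> (0 : R).
  have ls : sin (y x) @[x --> -oo] --> (0 : R).
    by rewrite -[0]sin0; exact: (continuous_cvg _ (@continuous_sin R 0) l0).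
  have -> : 0 = hamiltonian 0 0 0 0 :> R by rewrite /hamiltonian sin0; ring.
  rewrite /h /hamiltonian sin0.
  apply: cvgB; last by apply: cvg_mull; apply: cvg_exprn.
  apply: cvgD; last first.
    apply: cvgM; first by apply: cvg_exprn.
    by apply: cvgB; [exact: cvg_cst | apply: cvg_mull; apply: cvg_exprn].
  apply: cvgD; last by apply: cvg_mull; apply: cvg_exprn.
  by apply: cvgB; [apply: cvg_exprn | apply: cvgM => //; apply: cvg_mull].
apply/eqP; rewrite eq_le -oppr_ge0; apply/andP; split.
  apply: (@ge0_of_ninfty _ (fun x => - h x) (fun=> 0) t) => //; last by move=> x _; der; ring.
  by rewrite -oppr0; apply: cvgN.
by apply: (@ge0_of_ninfty _ h (fun=> 0) t).
Qed.

(** The left-hand side is the derivative of [M ^+ 2 + M1 ^+ 2 + q ^+ 2] along the linear system for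
    [M], [M1], [q], with [N] written as [q * (y1 + sin y)]. Each mixed product is absorbed into
    squares. *)
Lemma gronwall_bound (P y y1 M M1 q : R) : y1 ^+ 2 <= P ->
  2 * M * M1 + 2 * M1 * ((6 * y1 ^+ 2 + 9 - 4 * sin y ^+ 2) * M
    + 4 * sin y * cos y * (q * (y1 + sin y))) + 2 * q * (M - cos y * q)
  <= (20 + 10 * P) * (M ^+ 2 + M1 ^+ 2 + q ^+ 2).
Proof.
move=> y1P; have := cos2Dsin2 y; have := sin_le1 y; have := sin_geN1 y.
have := cos_le1 y; have := cos_geN1 y; have := sin_cos_bound y.
move: (sin y) (cos y) => s c /andP[sc1 sc2] c1 c2 s1 s2 E.
have P0 : 0 <= P by apply: le_trans y1P; exact: sqr_ge0.
have h1 : 2 * M * M1 <= M ^+ 2 + M1 ^+ 2 by have := sqr_ge0 (M - M1); nra.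
have h2 : 2 * M1 * ((6 * y1 ^+ 2 + 9 - 4 * s ^+ 2) * M)
    <= (6 * P + 9) * (M ^+ 2 + M1 ^+ 2).
  apply: (@le_trans _ _ ((6 * y1 ^+ 2 + 9 - 4 * s ^+ 2) * (M ^+ 2 + M1 ^+ 2))).
    have a0 : 0 <= 6 * y1 ^+ 2 + 9 - 4 * s ^+ 2 by have := sqr_ge0 y1; nra.
    by have := ler_wpM2l a0 h1; lra.
  by rewrite ler_wpM2r ?addr_ge0 ?sqr_ge0 //; have := sqr_ge0 s; lra.
have h3 : 2 * M1 * (4 * s * c * (q * (y1 + s))) <= (4 * P + 4) * (M1 ^+ 2 + q ^+ 2).
  have ub : `|2 * (s * c)| <= 1 by rewrite ler_norml; apply/andP; split; lra.
  have vb : `|y1 + s| <= (P + 3) / 2.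
    by have := sqr_ge0 (y1 - 1); have := sqr_ge0 (y1 + 1); rewrite ler_norml => ? ?;
      apply/andP; split; nra.
  have mb : `|2 * (M1 * q)| <= M1 ^+ 2 + q ^+ 2.
    by have := sqr_ge0 (M1 - q); have := sqr_ge0 (M1 + q); rewrite ler_norml => ? ?;
      apply/andP; split; nra.
  have := ler_pM (mulr_ge0 _ _) _ (ler_pM _ _ ub vb) mb; rewrite !normr_ge0.
  move=> /(_ isT isT isT isT isT); rewrite -!normrM mul1r => h.
  have -> : 2 * M1 * (4 * s * c * (q * (y1 + s))) =
    2 * (2 * (s * c) * (y1 + s) * (2 * (M1 * q))) by ring.
  have := le_trans (ler_norm _) h.
  by have := mulr_ge0 P0 (sqr_ge0 M1); have := mulr_ge0 P0 (sqr_ge0 q);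
    have := sqr_ge0 M1; have := sqr_ge0 q; lra.
have h4 : 2 * q * (M - c * q) <= q ^+ 2 + M ^+ 2 + 2 * q ^+ 2.
  by have := sqr_ge0 (q - M); have := sqr_ge0 q; nra.
have := mulr_ge0 P0 (sqr_ge0 M); have := mulr_ge0 P0 (sqr_ge0 M1).
have := mulr_ge0 P0 (sqr_ge0 q); have := sqr_ge0 M; have := sqr_ge0 M1.
have := sqr_ge0 q; move: h1 h2 h3 h4; lra.
Qed.

(** First [y1 > sin y] near [-oo]. If [y >= 0] at such a time, [blowup] applies there; otherwise
    [a < 0], and far enough out [- y] satisfies the hypotheses of [turning_absurd]. *)
Lemma positive_tension_absurd (y y1 y2 y3 : R -> R) (a t0 : R) :
  zero_energy y y1 y2 y3 -> y t * expR (- t) @[t --> -oo] --> a ->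
  y1 t * expR (- t) @[t --> -oo] --> a -> y2 t * expR (- t) @[t --> -oo] --> a ->
  (forall t, t <= t0 -> sin (y t) * cos (y t) < y2 t) -> False.
Proof.
move=> Z la l1a l2a M0; have [D0 D1 D2 _] := Z.
have l0 := cvg0_of_expR la; have l1 := cvg0_of_expR l1a.
have n01 : `|0 : R| < 1 by rewrite normr0.
have [s0 hs0] := near_ninfty_ex (cvgr_lt _ (cvg_norm l0) _ n01).
pose s1 := Num.min s0 t0.
have y_small t : t <= s1 -> -1 < y t < 1.
  by move=> ts1; rewrite -ltr_norml hs0 // (le_trans ts1) // ge_min lexx.
have pih := pihalf_ge1 R.
(* For [q = y1 - sin y] one has [q' = M - cos y * q] with [cos y >= 0] here, so [q' > 0] wherever
   [q <= 0]. *)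
have q_gt0 t : t <= s1 -> sin (y t) < y1 t.
  rewrite -subr_gt0.
  have dq (x : R) : is_derive x 1 (fun x => y1 x - sin (y x)) (y2 x - cos (y x) * y1 x).
    by der.
  have lq : y1 t - sin (y t) @[t --> -oo] --> (0 : R).
    have -> : 0 = 0 - sin 0 :> R by rewrite sin0 subr0.
    exact: cvgB l1 (continuous_cvg _ (@continuous_sin R 0) l0).
  apply: (gt0_of_ninfty lq (fun x _ => dq x)) => x xs1 q0.
  have c0 : 0 <= cos (y x).
    apply: cos_ge0_pihalf; have := y_small x xs1; move: pih; move: (pi / 2) => p.
    by move=> ? /andP[? ?]; apply/andP; split; lra.
  have Mx : sin (y x) * cos (y x) < y2 x by apply: M0; rewrite (le_trans xs1) // ge_min lexx orbT.
  have : 0 <= cos (y x) * (sin (y x) - y1 x) by rewrite mulr_ge0 // -oppr_le0 opprB.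
  by rewrite mulrBr; lra.
have [[t ts1 yt]|yneg] := pselect (exists2 t, t <= s1 & 0 <= y t).
  have sy : 0 <= sin (y t).
    have /andP[_ yt1] := y_small t ts1; have := pi_ge2 R => pi2.
    by apply: sin_ge0_pi; rewrite yt /=; move: pi2; move: (pi : R) => p ?; lra.
  have q0 := q_gt0 t ts1.
  apply: (blowup Z (t0 := t)); first exact: le_lt_trans q0.
    by rewrite subr_gt0 ltr_pXn2r // nnegrE // (le_trans sy) // ltW.
  by rewrite subr_gt0 M0 // (le_trans ts1) // ge_min lexx orbT.
have z_gt0 t : t <= s1 -> 0 < - y t.
  by move=> ts1; rewrite oppr_gt0 ltNge; apply/negP => yt; apply: yneg; exists t.
(* [- y * expR (- t)] decreases, so its limit [- a] at [-oo] is positive. *)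
have a0 : a < 0.
  have dg (x : R) : is_derive x 1 (fun t => y t * expR (- t)) ((y1 x - y x) * expR (- x)).
    by der; ring.
  have g_le t : t <= s1 -> y t * expR (- t) <= y s1 * expR (- s1).
    move=> ts1; apply: (der_ge0_le ts1 (fun x _ => dg x)) => x /andP[_ xs1].
    rewrite mulr_ge0 ?expR_ge0 //.
    have := q_gt0 x xs1; have := sin_le_id (ltW (z_gt0 x xs1)).
    by rewrite sinN; lra.
  apply: (@le_lt_trans _ _ (y s1 * expR (- s1))).
    rewrite leNgt; apply/negP => /(cvgr_gt _ la) gy.
    have [u hu] := near_ninfty_ex gy.
    have := hu (Num.min u s1); rewrite ge_min lexx => /(_ isT); rewrite ltNge g_le //.
    by rewrite ge_min lexx orbT.
  by rewrite pmulr_llt0 ?expR_gt0 // -oppr_gt0 z_gt0.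
(* Since [3 * a < 0], eventually [y2 + 2 * y1 < 0], hence [y2 + 3 sin y < y2 + 3 y1 < y1]: the
   Riccati quotient of [- y] exceeds 1. *)
have l21 : (y2 t + 2 * y1 t) * expR (- t) @[t --> -oo] --> 3 * a.
  have -> : 3 * a = a + 2 * a by ring.
  suff -> : (fun t => (y2 t + 2 * y1 t) * expR (- t)) =
      (fun t => y2 t * expR (- t) + 2 * (y1 t * expR (- t))).
    exact: cvgD l2a (cvg_mull (k:=2) l1a).
  by apply/funext => t; ring.
have [u1 hu1] := near_ninfty_ex (cvgr_lt _ l1a _ a0).
have a30 : 3 * a < 0 by lra.
have [u2 hu2] := near_ninfty_ex (cvgr_lt _ l21 _ a30).
pose t := Num.min (Num.min u1 u2) s1.
have ts1 : t <= s1 by rewrite ge_min lexx orbT.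
have y1t : y1 t < 0 by have := hu1 t; rewrite !ge_min lexx pmulr_llt0 ?expR_gt0 //; apply.
have y21t : y2 t + 2 * y1 t < 0.
  by have := hu2 t; rewrite !ge_min lexx orbT pmulr_llt0 ?expR_gt0 //; apply.
have q0 := q_gt0 t ts1.
apply: (turning_absurd (zero_energyN Z) (t1 := t)).
- exact: z_gt0.
- by have := pi_ge2 R; have := y_small t ts1; move: (pi : R) => p /andP[? ?] ?; lra.
- by rewrite oppr_gt0.
- by rewrite sinN !sqrrN; nra.
- by rewrite sinN cosN mulNr ltrN2 M0 // (le_trans ts1) // ge_min lexx orbT.
- by rewrite sinN; lra.
Qed.

(** * Classification of the entire solutions *)

Section Classification.
Variables (y y1 y2 y3 y4 : R -> R) (a : R).
Hypothesis Z : zero_energy y y1 y2 y3.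
Hypothesis D3 : forall t : R, is_derive t 1 y3 (y4 t).
Hypothesis ode : forall t, polar_ode (y t) (y1 t) (y2 t) (y4 t).
Hypothesis la : y t * expR (- t) @[t --> -oo] --> a.
Hypothesis l1a : y1 t * expR (- t) @[t --> -oo] --> a.
Hypothesis l2a : y2 t * expR (- t) @[t --> -oo] --> a.

Let M t := y2 t - sin (y t) * cos (y t).
Let M1 t := y3 t - (1 - 2 * sin (y t) ^+ 2) * y1 t.
Let N t := y1 t ^+ 2 - sin (y t) ^+ 2.
Let q t := y1 t - sin (y t).

Let l0 : y t @[t --> -oo] --> (0 : R). Proof. exact: cvg0_of_expR la. Qed.
Let l1 : y1 t @[t --> -oo] --> (0 : R). Proof. exact: cvg0_of_expR l1a. Qed.
Let l2 : y2 t @[t --> -oo] --> (0 : R). Proof. exact: cvg0_of_expR l2a. Qed.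

Let ls : sin (y t) @[t --> -oo] --> (0 : R).
Proof. by rewrite -[0]sin0; exact: (continuous_cvg _ (@continuous_sin R 0) l0). Qed.

Let lM : M t @[t --> -oo] --> (0 : R).
Proof.
have lc : cos (y t) @[t --> -oo] --> (1 : R).
  by rewrite -[1]cos0; exact: (continuous_cvg _ (@continuous_cos R 0) l0).
have -> : 0 = 0 - 0 * 1 :> R by ring.
exact: cvgB l2 (cvgM ls lc).
Qed.

Let lN : N t @[t --> -oo] --> (0 : R).
Proof.
have -> : 0 = 0 ^+ 2 - 0 ^+ 2 :> R by ring.
exact: cvgB (cvg_exprn (n:=2) l1) (cvg_exprn (n:=2) ls).
Qed.

Let lq : q t @[t --> -oo] --> (0 : R).
Proof. have -> : 0 = 0 - 0 :> R by ring.
exact: cvgB l1 ls. Qed.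

Let dM (t : R) : is_derive t 1 M (M1 t).
Proof.
have [D0 D1 D2 _] := Z; rewrite /M; der; rewrite /M1; have E := cos2sin2 (y t); ring: E.
Qed.

Let dM1 (t : R) : is_derive t 1 M1 ((6 * y1 t ^+ 2 + 9 - 4 * sin (y t) ^+ 2) * M t
  + 4 * sin (y t) * cos (y t) * N t).
Proof.
have [D0 D1 D2 _] := Z; rewrite /M1; der; rewrite (ode t) /M /N.
have E := cos2sin2 (y t); ring: E.
Qed.

Let dN (t : R) : is_derive t 1 N (2 * y1 t * M t).
Proof. have [D0 D1 D2 _] := Z; rewrite /N; der; rewrite /M; ring. Qed.

Let dq (t : R) : is_derive t 1 q (M t - cos (y t) * q t).
Proof. have [D0 D1 D2 _] := Z; rewrite /q; der; rewrite /M /q; ring. Qed.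

(* Maximum principle for [M], on a half-line where the coupling with [N] is small. *)
Lemma tension_max_principle : exists t0, forall t1, t1 <= t0 -> M t1 = 0 ->
  forall t, t <= t1 -> M t = 0.
Proof.
pose C := `|a| + 1.
have C0 : 0 < C by rewrite ltr_wpDl.
have [s0 hs0] : exists s0, forall t, t <= s0 -> `|y1 t| <= C * expR t.
  have : `|a| < C by rewrite ltrDl.
  move=> aC; have [s0 hs] := near_ninfty_ex (cvgr_lt _ (cvg_norm l1a) _ aC).
  exists s0 => t /hs /ltW.
  by rewrite normrM [`|expR _|]ger0_norm ?expR_ge0 // expRN ler_pdivrMr ?expR_gt0.
have [s1 hs1] : exists s1, forall t, t <= s1 -> C * expR t <= 1 / 2.
  have lC := @cvg_mull _ C _ (@expR_ninfty R).
  have C2 : C * 0 < 1 / 2 by rewrite mulr0 divr_gt0.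
  have [s1 hs] := near_ninfty_ex (cvgr_lt _ lC _ C2).
  by exists s1 => t /hs /ltW.
exists (Num.min s0 s1) => t1; rewrite le_min => /andP[t1s0 t1s1] Mt1 t2 t2t1.
apply/eqP; rewrite -sqrf_eq0 eq_le sqr_ge0 andbT leNgt; apply/negP => Mt2.
have lM2 : M t ^+ 2 @[t --> -oo] --> (0 : R).
  have -> : 0 = 0 ^+ 2 :> R by ring.
  exact: (cvg_exprn (n:=2) lM).
have [s hs] := near_ninfty_ex (cvgr_lt _ lM2 _ Mt2).
have dM2 (t : R) : is_derive t 1 (fun t => M t ^+ 2) (2 * (M t * M1 t)) by der; ring.
pose t3 := Num.min s t2.
have t32 : t3 <= t2 by rewrite ge_min lexx orbT.
have t31 : t3 <= t1 := le_trans t32 t2t1.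
(* The choice of [t3] makes this a maximum of [M ^+ 2] over all times up to [t1], and [M t1 = 0]
   gives [c < t1]. *)
have [|c] := @EVT_max R (fun t => M t ^+ 2) t3 t1 t31.
  by apply: (der_within (fun x _ => dM2 x)).
rewrite in_itv /= => /andP[t3c ct1] cmax.
have Mc : M t2 ^+ 2 <= M c ^+ 2 by apply: cmax; rewrite in_itv /= t32 t2t1.
have Mc0 := lt_le_trans Mt2 Mc.
have {}cmax x : x <= t1 -> M x ^+ 2 <= M c ^+ 2.
  move=> xt1; have [/ltW xt3|t3x] := ltP x t3; last by apply: cmax; rewrite in_itv /= t3x.
  by apply: le_trans Mc; apply: ltW; apply: hs; rewrite (le_trans xt3) // ge_min lexx.
have ct1' : c < t1.
  by rewrite lt_neqAle ct1 andbT; apply: contraTneq Mc0 => ->; rewrite Mt1 expr0n ltxx.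
pose m := `|M c|.
have m0 : 0 < m by rewrite normr_gt0 -sqrf_eq0 gt_eqF.
have M_le_m x : x <= t1 -> `|M x| <= m.
  by move=> /cmax; rewrite -ler_sqrt ?sqr_ge0 // !sqrtr_sqr.
(* [N' = 2 y1 M] is bounded by [2 C m e^t]. Integration from [-oo], where [N] tends to 0, gives the
   bound [2 C m e^c <= m]. *)
have Nc : `|N c| <= m.
  have bnd x : x <= c -> `|2 * y1 x * M x| <= 2 * C * m * expR x.
    move=> xc; rewrite !normrM ger0_norm // -!mulrA ler_pM2l // [m * _]mulrC mulrA.
    apply: ler_pM => //; last by apply: M_le_m; exact: le_trans ct1.
    by apply: hs0; apply: le_trans t1s0; exact: le_trans ct1.
  have dE (k x : R) : is_derive x 1 (fun t => 2 * C * m * expR t + k * N t)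
      (2 * C * m * expR x + k * (2 * y1 x * M x)) by der; ring.
  have lE (k : R) : 2 * C * m * expR t + k * N t @[t --> -oo] --> (0 : R).
    have -> : 0 = 2 * C * m * 0 + k * 0 :> R by ring.
    exact: cvgD (cvg_mull (k:=2 * C * m) (@expR_ninfty R)) (cvg_mull (k:=k) lN).
  have sgn (k : R) : `|k| = 1 -> 0 <= 2 * C * m * expR c + k * N c.
    move=> s1'; apply: (ge0_of_ninfty (lE k) (fun x _ => dE k x) _ (lexx c)) => x xc.
    have := bnd x xc; rewrite -[`|_ * _|]mul1r -s1' -normrM ler_norml => /andP[+ _].
    by rewrite -subr_ge0 opprK addrC.
  have e1 : 2 * C * m * expR c <= m.
    by have := hs1 c (le_trans ct1 t1s1); rewrite -(ler_pM2l m0); lra.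
  rewrite ler_norml.
  have := sgn 1 (normr1 _); have := sgn (-1) (normrN1 _).
  by move=> ? ?; apply/andP; split; lra.
pose G x := M x * M1 x.
have dG (x : R) : is_derive x 1 G (M1 x ^+ 2 + M x *
    ((6 * y1 x ^+ 2 + 9 - 4 * sin (y x) ^+ 2) * M x + 4 * sin (y x) * cos (y x) * N x)).
  by rewrite /G; der; ring.
(* The coefficient of [M c ^+ 2] is at least 5, while the coupling with [N] costs at most
   [2 * m ^+ 2]. *)
have Gc0 : 0 < M1 c ^+ 2 + M c * ((6 * y1 c ^+ 2 + 9 - 4 * sin (y c) ^+ 2) * M c
     + 4 * sin (y c) * cos (y c) * N c).
  have mE : M c ^+ 2 = m ^+ 2 by rewrite real_normK ?num_real.
  have /andP[sc1 sc2] := sin_cos_bound (y c).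
  have MN : `|M c * N c| <= m ^+ 2 by rewrite normrM expr2 ler_pM.
  have : `|(sin (y c) * cos (y c)) * (M c * N c)| <= 1 / 2 * m ^+ 2.
    by rewrite normrM ler_pM // ler_norml sc1.
  rewrite ler_norml => /andP[h _].
  have s1' : sin (y c) ^+ 2 <= 1.
    by have := sqr_ge0 (cos (y c)); rewrite cos2sin2 subr_ge0.
  have -> : M c * ((6 * y1 c ^+ 2 + 9 - 4 * sin (y c) ^+ 2) * M c
      + 4 * sin (y c) * cos (y c) * N c) =
    (6 * y1 c ^+ 2 + 9 - 4 * sin (y c) ^+ 2) * M c ^+ 2
      + 4 * (sin (y c) * cos (y c) * (M c * N c)) by ring.
  have : 5 * m ^+ 2 <= (6 * y1 c ^+ 2 + 9 - 4 * sin (y c) ^+ 2) * M c ^+ 2.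
    by rewrite mE ler_wpM2r ?sqr_ge0 //; have := sqr_ge0 (y1 c); lra.
  by have := sqr_ge0 (M1 c); have := exprn_gt0 2 m0; move: h; lra.
have Gc : G c = 0.
  have c1 : c - 1 < c by rewrite ltrBlDr ltrDl.
  have [||||_ d0] := @derive1_at_max R (fun t => M t ^+ 2) (c - 1) t1 c.
  - exact: ltW (lt_trans c1 ct1').
  - by move=> t _; have [] := dM2 t.
  - by rewrite in_itv /= c1.
  - by move=> t; rewrite in_itv /= => /andP[_ /ltW/cmax].
  have [_ d1] := dM2 c; move: d0; rewrite d1 => /eqP.
  by rewrite mulf_eq0 pnatr_eq0 /= => /eqP.
(* [G] is half the derivative of [M ^+ 2]; it vanishes at [c] with positive slope, so [M ^+ 2] would
   exceed its maximum just after [c]. *)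
have [e e0 he] := der_sign (dG c) Gc0.
pose x := Num.min t1 (c + e / 2).
have cx : c < x by rewrite lt_min ct1' ltrDl divr_gt0.
have xe : x <= c + e / 2 by rewrite ge_min lexx orbT.
have G_gt0 z : c < z -> z <= x -> 0 < G z.
  move=> cz zx; rewrite -Gc; have [|+ _] := he z; last exact.
  by rewrite gtr0_norm ?subr_gt0 //; lra.
have : M c ^+ 2 < M x ^+ 2.
  pose x' := (c + x) / 2.
  have [cx' x'x] : c < x' /\ x' < x by rewrite /x'; split; lra.
  apply: (@le_lt_trans _ _ (M x' ^+ 2)).
    apply: (der_ge0_le (ltW cx') (fun z _ => dM2 z)) => z /andP[cz zx'].
    rewrite mulr_ge0 //; move: cz; rewrite le_eqVlt => /orP[/eqP <-|cz].
      by rewrite -/(G c) Gc.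
    by apply/ltW/G_gt0 => //; apply: le_trans (ltW x'x).
  apply: (der_gt0_lt x'x (fun z _ => dM2 z)) => z /andP[x'z zx].
  by rewrite mulr_gt0 //; apply: G_gt0 => //; apply: lt_le_trans x'z.
by rewrite ltNge cmax // ge_min lexx.
Qed.


(* Vanishing of [M] near [-oo] propagates: [(q, M, M1)] solves a linear system. *)
Lemma tension0_flow t1 : (forall t, t <= t1 -> M t = 0) -> forall t, y1 t = sin (y t).
Proof.
have [D0 D1 D2 _] := Z => M0.
have n01 : `|0 : R| < 1 by rewrite normr0.
have [s0 hs0] := near_ninfty_ex (cvgr_lt _ (cvg_norm l0) _ n01).
pose t2 := Num.min s0 t1.
(* With [M = 0], the function [- q ^+ 2] has derivative [2 q ^+ 2 cos y >= 0] and tends to 0 at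
   [-oo]. *)
have q0 t : t <= t2 -> q t = 0.
  rewrite le_min => /andP[ts0 tt1].
  have dq2 (x : R) : is_derive x 1 (fun t => - q t ^+ 2)
    (- (2 * q x * (M x - cos (y x) * q x))) by der; ring.
  have lq2 : - q t ^+ 2 @[t --> -oo] --> (0 : R).
    have -> : 0 = - 0 ^+ 2 :> R by ring.
    exact: cvgN (cvg_exprn (n:=2) lq).
  apply/eqP; rewrite -sqrf_eq0 eq_le sqr_ge0 andbT -oppr_ge0.
  apply: (ge0_of_ninfty lq2 (fun x _ => dq2 x) _ (lexx t)) => x xt.
  rewrite M0 ?(le_trans xt) //.
  have -> : - (2 * q x * (0 - cos (y x) * q x)) = 2 * q x ^+ 2 * cos (y x) by ring.
  rewrite mulr_ge0 //; first by rewrite mulr_ge0 ?sqr_ge0.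
  apply: cos_ge0_pihalf.
  have := hs0 x (le_trans xt ts0); rewrite ltr_norml => /andP[? ?].
  by have := pihalf_ge1 R; move: (pi / 2) => p ?; apply/andP; split; lra.
(* Moving back by 1 places the point inside a full neighbourhood on which [M] vanishes. *)
have M10 : M1 (t2 - 1) = 0.
  have [_ d1] := dM (t2 - 1); rewrite -d1.
  have -> : 'D_1 M (t2 - 1) = 'D_1 (fun=> 0 : R) (t2 - 1).
    have h : t2 - 1 < t2 by rewrite ltrBlDr ltrDl.
    apply: near_eq_derive; near=> x; apply: M0.
    have xt2 : x <= t2 by apply: ltW; near: x; exact: lt_nbhsl.
    by rewrite (le_trans xt2) // ge_min lexx orbT.
  exact: derive_cst.
move=> t; have [/q0/eqP|t2t] := leP t t2; first by rewrite subr_eq0 => /eqP.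
have t2t' : t2 - 1 <= t by apply: ltW; apply: lt_trans t2t; rewrite ltrBlDr ltrDl.
have [|c _ cmax] := @EVT_max R (fun x => y1 x ^+ 2) (t2 - 1) t t2t'.
  have d2 (x : R) : is_derive x 1 (fun x => y1 x ^+ 2) (2 * y1 x * y2 x) by der; ring.
  exact: (der_within (fun x _ => d2 x)).
(* On the compact interval [y1 ^+ 2] is at most [y1 c ^+ 2], so [gronwall_bound] yields
   [W' <= K * W]. *)
pose K := 20 + 10 * y1 c ^+ 2.
pose W x := M x ^+ 2 + M1 x ^+ 2 + q x ^+ 2.
have dW (x : R) : is_derive x 1 (fun x => W x * expR (- K * x))
   ((2 * M x * M1 x + 2 * M1 x * ((6 * y1 x ^+ 2 + 9 - 4 * sin (y x) ^+ 2) * M x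
  + 4 * sin (y x) * cos (y x) * N x) + 2 * q x * (M x - cos (y x) * q x) - K * W x)
   * expR (- K * x)) by rewrite /W; der; ring.
have Wt2 : W (t2 - 1) = 0.
  have h : t2 - 1 <= t2 by rewrite lerBlDr lerDl.
  rewrite /W M10 q0 // M0 ?expr0n /= ?addr0 //; apply: le_trans h _.
  by rewrite ge_min lexx orbT.
have : W t * expR (- K * t) <= W (t2 - 1) * expR (- K * (t2 - 1)).
  apply: (der_le0_ge t2t' (fun x _ => dW x)) => x xI.
  rewrite mulr_le0_ge0 ?expR_ge0 // subr_le0 /W /K.
  have := cmax x; rewrite in_itv /= xI => /(_ isT).
  have -> : N x = q x * (y1 x + sin (y x)) by rewrite /N /q; ring.
  exact: gronwall_bound.
rewrite Wt2 mul0r pmulr_lle0 ?expR_gt0 // => W0; apply/eqP; rewrite -subr_eq0 -/(q t).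
rewrite -sqrf_eq0 eq_le sqr_ge0 andbT; apply: le_trans W0.
by rewrite lerDr addr_ge0 ?sqr_ge0.
Unshelve. all: by end_near. Qed.

(** A zero of [M] before [t0] spreads to [-oo] and then gives the flow of [sin]. Without such a zero
    [M] keeps its sign up to [t0], and both signs are absurd, the negative one through
    [y -> - y]. *)
Lemma entire_solution : exists l, forall t, y t = 2 * atan (l * expR t).
Proof.
have [D0 D1 D2 _] := Z.
have [t0 ht0] := tension_max_principle.
have [[t1 t10 /(ht0 _ t10) M0]|nM] := pselect (exists2 t1, t1 <= t0 & M t1 = 0).
  have flow := tension0_flow M0.
  have n01 : `|0 : R| < 1 by rewrite normr0.
  have [s0 hs0] := near_ninfty_ex (cvgr_lt _ (cvg_norm l0) _ n01).
  apply: (@sin_flow _ y s0); last exact: ltW (hs0 _ (lexx _)).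
  by move=> t; rewrite -flow.
exfalso.
have M_neq0 t : t <= t0 -> M t != 0 by move=> tt0; apply/eqP => Mt; apply: nM; exists t.
have [M0|] := ltP 0 (M t0).
  apply: (positive_tension_absurd Z la l1a l2a (t0 := t0)) => t tt0.
  rewrite -subr_gt0 -/(M t) ltNge; apply/negP => Mt.
  have [|||T [tT Tt0 MT _]] := @first_zero _ (fun x => - M x) t t0 tt0.
  - by move=> x _; exact: der_cont (der_opp (dM x)).
  - by rewrite oppr_gt0 lt_neqAle Mt M_neq0.
  - by rewrite oppr_le0 ltW.
  by move: (M_neq0 T Tt0); rewrite -oppr_eq0 MT eqxx.
rewrite le_eqVlt (negbTE (M_neq0 t0 _)) //= => M0.
have opp f : f t * expR (- t) @[t --> -oo] --> a ->
    - f t * expR (- t) @[t --> -oo] --> - a.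
  move=> fa; suff -> : (fun t => - f t * expR (- t)) = (fun t => - (f t * expR (- t))).
    exact: cvgN fa.
  by apply/funext => t; rewrite mulNr.
apply: (positive_tension_absurd (zero_energyN Z) (opp _ la) (opp _ l1a) (opp _ l2a) (t0 := t0)).
move=> t tt0; rewrite sinN cosN mulNr ltrN2 -subr_lt0 -/(M t) ltNge; apply/negP => Mt.
have [|||T [tT Tt0 MT _]] := @first_zero _ M t t0 tt0.
- by move=> x _; exact: der_cont (dM x).
- by rewrite lt_neqAle Mt eq_sym M_neq0.
- exact: ltW.
by move: (M_neq0 T Tt0); rewrite MT eqxx.
Qed.

End Classification.
End Entire.

(** * From the half-line to the logarithmic variable *)

Section Polar.
Local Open Scope classical_set_scope.
Local Open Scope ring_scope.
Context {R : realType}.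
Variable d : nat -> R -> R.

(* If [d k] is the [k]-th derivative of [psi], then [polar k] is the [k]-th
   derivative of [t |-> psi (e ^ t)]. *)
Definition polar k (t : R) : R := nth 0 [::
  d 0 (expR t);
  expR t * d 1 (expR t);
  expR t ^+ 2 * d 2 (expR t) + expR t * d 1 (expR t);
  expR t ^+ 3 * d 3 (expR t) + 3 * expR t ^+ 2 * d 2 (expR t) + expR t * d 1 (expR t);
  expR t ^+ 4 * d 4 (expR t) + 6 * expR t ^+ 3 * d 3 (expR t)
    + 7 * expR t ^+ 2 * d 2 (expR t) + expR t * d 1 (expR t)] k.

Lemma polar_der k (t : R) :
  (forall n (t : R), is_derive t 1 (fun x => d n (expR x)) (expR t * d n.+1 (expR t))) ->
  (k < 4)%N -> is_derive t 1 (polar k) (polar k.+1 t).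
Proof.
move=> D; have D0 := D 0%N; have D1 := D 1%N; have D2 := D 2%N; have D3 := D 3%N.
by case: k => [|[|[|[|]]]] // _; rewrite /polar /=; der; ring.
Qed.

(** For [k] from 1 to 3, dividing by [expR t] leaves [d 1 (expR t)] with coefficient 1 and terms
    that keep a factor [expR t]; for [k = 0] it gives the difference quotient at 0. *)
Lemma polar_ninfty k : (d 0 (expR t)) * expR (- t) @[t --> -oo] --> d 1 0 ->
  (forall n, d n (expR t) @[t --> -oo] --> d n 0) -> (k < 4)%N ->
  polar k t * expR (- t) @[t --> -oo] --> d 1 0.
Proof.
move=> q j; have j1 := j 1%N; have j2 := j 2%N; have j3 := j 3%N.
have E0 := @expR_ninfty R.
have EV (t : R) : expR t * expR (- t) = 1 by rewrite -expRD subrr expR0.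
case: k => [|[|[|[|]]]] // _; rewrite /polar /=.
- rewrite (_ : (fun t => _) = (fun t => d 1 (expR t))) //.
  by apply/funext => t; rewrite mulrAC EV mul1r.
- rewrite (_ : (fun t => _) = (fun t => expR t * d 2 (expR t) + d 1 (expR t))).
    have -> : d 1 0 = 0 * d 2 0 + d 1 0 by ring.
    exact: cvgD (cvgM E0 j2) j1.
  by apply/funext => t; have EVt := EV t; ring: EVt.
- rewrite (_ : (fun t => _) = (fun t => expR t * expR t * d 3 (expR t)
      + 3 * (expR t * d 2 (expR t)) + d 1 (expR t))).
    have -> : d 1 0 = 0 * 0 * d 3 0 + 3 * (0 * d 2 0) + d 1 0 by ring.
    exact: cvgD (cvgD (cvgM (cvgM E0 E0) j3) (cvg_mull (k:=3) (cvgM E0 j2))) j1.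
  by apply/funext => t; have EVt := EV t; ring: EVt.
Qed.
End Polar.

(** * Derivatives on the half-line *)

Section HalfLineRegularity.
Local Open Scope classical_set_scope.
Local Open Scope ring_scope.
Context {R : realType}.
Variable psi : R -> R.
Hypothesis psi_smooth : smooth_half_line psi.

Definition jet k := iter k half_line_derive psi.

Let quotient_cvg k (r : R) : 0 <= r ->
  (jet k s - jet k r) / (s - r) @[s --> within half_line r^'] --> jet k.+1 r.
Proof. by move=> r0; exact: psi_smooth. Qed.

(** A neighbourhood of [r > 0] lies in the half-line, so the restricted quotient has an unrestricted
    limit there. *)
Lemma jet_der k (r : R) : 0 < r -> is_derive r 1 (jet k) (jet k.+1 r).
Proof.
move=> r0; apply/is_derive1_caratheodory.
pose g s := if s == r then jet k.+1 r else (jet k s - jet k r) / (s - r).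
exists g; split; last by rewrite /g eqxx.
  move=> z; rewrite /g; have [->|zr] := eqVneq z r; first by rewrite !subrr mulr0.
  by rewrite divfK // subr_eq0.
have gr : g r = jet k.+1 r by rewrite /g eqxx.
rewrite /prop_for /continuous_at gr; apply/cvgrPdist_lt => e e0.
have /cvgrPdist_lt/(_ e e0) := @quotient_cvg k r (ltW r0).
rewrite near_withinE /dnbhs near_withinE => h.
near=> s; rewrite /g; case: eqVneq => [_|sr]; first by rewrite subrr normr0.
have s0 : half_line s by apply: ltW; near: s; exact: lt_nbhsr.
by move: sr s0; near: s.
Unshelve. all: by end_near. Qed.

(** Turns one-sided limits at the origin into limits at [-oo]: [expR t] tends to 0 through positive
    values. *)
Let expR_dnbhs0 : expR t @[t --> -oo] --> within half_line (0 : R)^'.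
Proof.
move=> P; rewrite /dnbhs /within /= => h.
have {}h : \forall t \near -oo, expR t != 0 -> half_line (expR t) -> P (expR t).
  exact: expR_ninfty h.
change (\forall t \near -oo, P (expR t)).
apply: filterS h => t; apply; [by rewrite gt_eqF ?expR_gt0 | exact: expR_ge0].
Qed.

Lemma jet_quotient_ninfty k :
  (jet k (expR t) - jet k 0) * expR (- t) @[t --> -oo] --> jet k.+1 0.
Proof.
suff -> : (fun t => (jet k (expR t) - jet k 0) * expR (- t)) =
    (fun s => (jet k s - jet k 0) / (s - 0)) \o expR.
  exact: cvg_comp _ _ expR_dnbhs0 (@quotient_cvg k 0 (lexx 0)).
by apply/funext => t /=; rewrite subr0 expRN.
Qed.

Lemma jet_ninfty k : jet k (expR t) @[t --> -oo] --> jet k 0.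
Proof.
suff -> : (fun t => jet k (expR t)) = (fun t => (jet k (expR t) - jet k 0) + jet k 0).
  rewrite -[X in _ --> X]add0r.
  exact: cvgD (cvg0_of_expR (@jet_quotient_ninfty k)) (cvg_cst (jet k 0)).
by apply/funext => t; rewrite subrK.
Qed.

Lemma jet_expR_der k (t : R) :
  is_derive t 1 (fun x => jet k (expR x)) (expR t * jet k.+1 (expR t)).
Proof.
notypeclasses refine (der_eq (der_comp (jet_der k (expR_gt0 t)) (is_derive_expR t)) _).
by rewrite mulrC.
Qed.

End HalfLineRegularity.

(** * Laplacians of radial functions *)

Section RadialLaplacian.
Local Open Scope classical_set_scope.
Local Open Scope ring_scope.
Context {R : realType}.
Local Notation V := 'rV[R]_4.
Implicit Types (x : V) (i j : 'I_4).

(** This is [ln |x|]; the squared norm inside is a polynomial along each coordinate line. *)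
Definition log_radius x : R := ln (dot x x) / 2.

Lemma dot_gt0 x : x != 0 -> 0 < dot x x.
Proof.
move=> x0; rewrite lt_neqAle sumr_ge0 ?andbT => [|i _]; last by rewrite -expr2 sqr_ge0.
apply: contraNneq x0 => /esym/eqP; rewrite psumr_eq0 => [/allP h|i _]; last first.
  by rewrite -expr2 sqr_ge0.
apply/eqP/rowP => i; rewrite mxE; apply/eqP.
by have := h i (mem_index_enum i); rewrite /= -expr2 sqrf_eq0.
Qed.

Lemma expR_log_radius x : x != 0 -> expR (log_radius x) ^+ 2 = dot x x.
Proof.
move=> /dot_gt0 x0; rewrite -expRM_natl /log_radius mulrC divfK ?pnatr_eq0 //.
by rewrite lnK // posrE.
Qed.

(** Reduces partial derivatives to one-variable calculus on a coordinate line. *)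
Lemma partial_line i (f : V -> R) x l :
  is_derive (0 : R) 1 (fun z => f (z *: basis_vec i + x)) l -> partial i f x = l.
Proof.
move=> [_ <-]; rewrite /partial /derive; congr (lim _).
suff -> : (fun h : R => h^-1 *: ((f \o shift x) (h *: basis_vec i) - f x)) =
   (fun h : R => h^-1 *: (((fun z : R => f (z *: basis_vec i + x)) \o shift 0) (h *: 1)
      - f (0 *: basis_vec i + x))) by [].
by apply/funext => h; rewrite /= scale0r add0r addr0 /GRing.scale /= mulr1.
Qed.

Lemma line_coord i j x : is_derive (0 : R) 1
  (fun z => (z *: basis_vec i + x) 0 j) (i == j)%:R.
Proof.
have -> : (fun z : R => (z *: basis_vec i + x) 0 j) = (fun z => z * (i == j)%:R + x 0 j).
  by apply/funext => z; rewrite /basis_vec !mxE eqxx /= eq_sym.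
by der; ring.
Qed.

Lemma dot_line i x (z : R) : dot (z *: basis_vec i + x) (z *: basis_vec i + x) =
  dot x x + 2 * x 0 i * z + z ^+ 2.
Proof.
rewrite /dot (eq_bigr (fun j => x 0 j * x 0 j + (i == j)%:R * (2 * x 0 j * z + z ^+ 2))).
  rewrite big_split /= -addrA; congr (_ + _); rewrite (bigD1 i) // eqxx mul1r -[RHS]addr0.
  by congr (_ + _); rewrite big1 // => j /negPf; rewrite eq_sym => ->; rewrite mul0r.
move=> j _; rewrite /basis_vec !mxE eqxx /= [j == i]eq_sym.
by case: (i == j) => /=; ring.
Qed.

Lemma line_log_radius i x : x != 0 -> is_derive (0 : R) 1
  (fun z => log_radius (z *: basis_vec i + x))
  (x 0 i * expR (- (2 * log_radius x))).
Proof.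
move=> x0; have d0 := dot_gt0 x0; rewrite /log_radius.
under eq_fun do rewrite dot_line.
have dp : is_derive (0 : R) 1 (fun z => dot x x + 2 * x 0 i * z + z ^+ 2) (2 * x 0 i).
  by der; ring.
have p0 : 0 < dot x x + 2 * x 0 i * 0 + 0 ^+ 2 by rewrite mulr0 expr0n /= !addr0.
pose g z := dot x x + 2 * x 0 i * z + z ^+ 2.
notypeclasses refine
  (der_eq (der_mul (der_comp (g := g) (is_derive1_ln p0) dp) (der_const _ _)) _).
rewrite mulr0 expr0n /= !addr0 expRN -/(log_radius x) expRM_natl expR_log_radius //.
by field; rewrite gt_eqF.
Qed.

Lemma line_radial i x (h : R -> R) l : x != 0 -> is_derive (log_radius x) 1 h l ->
  is_derive (0 : R) 1 (fun z => h (log_radius (z *: basis_vec i + x)))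
    (l * (x 0 i * expR (- (2 * log_radius x)))).
Proof.
move=> x0 hl; apply: (der_comp _ (line_log_radius i x0)).
by rewrite scale0r add0r.
Qed.

(** Differentiation is local and the complement of the origin is open; the explicit formulas below
    hold only there. *)
Lemma partial_off0 i (f g : V -> R) x : x != 0 -> (forall y, y != 0 -> f y = g y) ->
  partial i f x = partial i g x.
Proof.
rewrite -normr_gt0 => nx fg; apply: near_eq_derive; near=> y; apply: fg.
by rewrite -normr_gt0; near: y; exact: cvgr_gt _ (@norm_continuous R V x) _ nx.
Unshelve. all: by end_near. Qed.

Let sum_sqr x : x != 0 ->
  (\sum_i x 0 i ^+ 2) * expR (- (2 * log_radius x)) = 1.
Proof.
move=> x0; rewrite expRN expRM_natl expR_log_radius // /dot.
under [X in _ / X]eq_bigr do rewrite -expr2.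
rewrite divff //; have := dot_gt0 x0; rewrite /dot.
by under eq_bigr do rewrite -expr2; move=> /gt_eqF/negbT.
Qed.

(** With [r = e^t], this is [h_rr + (3 / r) h_r], the radial Laplacian in dimension 4. *)
Lemma laplacian_radial (f : V -> R) (h h1 h2 : R -> R) :
  (forall t : R, is_derive t 1 h (h1 t)) -> (forall t : R, is_derive t 1 h1 (h2 t)) ->
  (forall x, x != 0 -> f x = h (log_radius x)) ->
  forall x, x != 0 -> laplacian f x =
    expR (- (2 * log_radius x)) * (h2 (log_radius x) + 2 * h1 (log_radius x)).
Proof.
move=> D0 D1 fh x x0.
pose k t := h1 t * expR (- (2 * t)).
have Dk (t : R) : is_derive t 1 k ((h2 t - 2 * h1 t) * expR (- (2 * t))).
  by rewrite /k; der; ring.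
have p1 i y : y != 0 -> partial i f y = y 0 i * k (log_radius y).
  move=> y0; rewrite (partial_off0 _ y0 fh); apply: partial_line.
  by apply: der_eq (line_radial i y0 (D0 _)) _; rewrite /k; ring.
set T := log_radius x; set E := expR (- (2 * T)).
rewrite /laplacian (eq_bigr (fun i => k T + x 0 i ^+ 2 * ((h2 T - 2 * h1 T) * E * E))).
  rewrite big_split /= sumr_const card_ord -mulr_suml -[k T *+ 4]mulr_natl.
  have -> : (\sum_i x 0 i ^+ 2) * ((h2 T - 2 * h1 T) * E * E) =
    ((\sum_i x 0 i ^+ 2) * E) * ((h2 T - 2 * h1 T) * E) by ring.
  by rewrite sum_sqr // /k -/E; ring.
move=> i _; rewrite (partial_off0 _ x0 (p1 i)); apply: partial_line.
apply: der_eq (der_mul (line_coord i i x) (line_radial i x0 (Dk _))) _.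
by rewrite scale0r add0r eqxx mul1r -/T -/E; ring.
Qed.

(** The product with [x 0 j] adds the cross term [2 x_j h_r / r], which raises the coefficient of
    [h1] from 2 to 4. *)
Lemma laplacian_coord_radial j (f : V -> R) (h h1 h2 : R -> R) :
  (forall t : R, is_derive t 1 h (h1 t)) -> (forall t : R, is_derive t 1 h1 (h2 t)) ->
  (forall x, x != 0 -> f x = x 0 j * h (log_radius x)) ->
  forall x, x != 0 -> laplacian f x =
    x 0 j * (expR (- (2 * log_radius x)) * (h2 (log_radius x) + 4 * h1 (log_radius x))).
Proof.
move=> D0 D1 fh x x0.
pose k t := h1 t * expR (- (2 * t)).
have Dk (t : R) : is_derive t 1 k ((h2 t - 2 * h1 t) * expR (- (2 * t))).
  by rewrite /k; der; ring.
have p1 i y : y != 0 -> partial i f y =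
    (i == j)%:R * h (log_radius y) + y 0 j * y 0 i * k (log_radius y).
  move=> y0; rewrite (partial_off0 _ y0 fh); apply: partial_line.
  apply: der_eq (der_mul (line_coord i j y) (line_radial i y0 (D0 _))) _.
  by rewrite scale0r add0r /k; ring.
set T := log_radius x; set E := expR (- (2 * T)).
rewrite /laplacian (eq_bigr (fun i => (i == j)%:R * (2 * x 0 i * k T) + (x 0 j * k T
    + x 0 i ^+ 2 * (x 0 j * ((h2 T - 2 * h1 T) * E * E))))).
  rewrite !big_split /= sumr_const card_ord -mulr_suml -[x 0 j * k T *+ 4]mulr_natl.
  rewrite (bigD1 j) //= eqxx mul1r big1 => [|i /negPf ->]; last by rewrite mul0r.
  have -> : (\sum_i x 0 i ^+ 2) * (x 0 j * ((h2 T - 2 * h1 T) * E * E)) =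
    ((\sum_i x 0 i ^+ 2) * E) * (x 0 j * ((h2 T - 2 * h1 T) * E)) by ring.
  by rewrite sum_sqr // /k -/E; ring.
move=> i _; rewrite (partial_off0 _ x0 (p1 i)); apply: partial_line.
apply: der_eq (der_add
  (der_mul (der_const _ _) (line_radial i x0 (D0 _)))
  (der_mul (der_mul (line_coord i j x) (line_coord i i x)) (line_radial i x0 (Dk _)))) _.
rewrite scale0r add0r eqxx [true%:R]mulr1n /k -/T -/E; ring.
Qed.

End RadialLaplacian.

(** * Bilaplacians in the logarithmic variable *)

Section Bilaplacian.
Local Open Scope classical_set_scope.
Local Open Scope ring_scope.
Context {R : realType}.
Variables f f1 f2 f3 f4 : R -> R.
Hypothesis D0 : forall t : R, is_derive t 1 f (f1 t).
Hypothesis D1 : forall t : R, is_derive t 1 f1 (f2 t).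
Hypothesis D2 : forall t : R, is_derive t 1 f2 (f3 t).
Hypothesis D3 : forall t : R, is_derive t 1 f3 (f4 t).

Let expR_mul2 (t : R) (a b : nat) :
  expR (- (a%:R * t)) * expR (- (b%:R * t)) = expR (- ((a + b)%:R * t)).
Proof. by rewrite -expRD natrD; congr expR; ring. Qed.

(** With [D = d/dt], the factor [e^(-2t)] turns [D^2 + 2D] into [D^2 - 2D] at the second
    application, and their product is [D^4 - 4 D^2]. *)
Lemma bilaplacian_radial (U : 'rV[R]_4 -> R) :
  (forall x, x != 0 -> U x = f (log_radius x)) -> forall x, x != 0 ->
  laplacian (laplacian U) x = expR (- (4 * log_radius x))
    * (f4 (log_radius x) - 4 * f2 (log_radius x)).
Proof.
move=> Uf; have L1 := laplacian_radial D0 D1 Uf.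
pose k t := expR (- (2 * t)) * (f2 t + 2 * f1 t).
pose k1 t := expR (- (2 * t)) * (f3 t - 4 * f1 t).
pose k2 t := expR (- (2 * t)) * (f4 t - 4 * f2 t - 2 * f3 t + 8 * f1 t).
have Dk (t : R) : is_derive t 1 k (k1 t) by rewrite /k /k1; der; ring.
have Dk1 (t : R) : is_derive t 1 k1 (k2 t) by rewrite /k1 /k2; der; ring.
move=> x x0; rewrite (laplacian_radial Dk Dk1 L1 x0) -(expR_mul2 _ 2 2) /k1 /k2.
by ring.
Qed.

(** The weights [e^(-t)] and [e^(-3t)] turn [D^2 + 4D] into [(D + 3)(D - 1)] and then
    [(D - 3)(D + 1)], with product [D^4 - 10 D^2 + 9]. *)
Lemma bilaplacian_coord_radial j (U : 'rV[R]_4 -> R) :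
  (forall x, x != 0 -> U x = x 0 j * (expR (- log_radius x) * f (log_radius x))) ->
  forall x, x != 0 -> laplacian (laplacian U) x = x 0 j * (expR (- (5 * log_radius x))
    * (f4 (log_radius x) - 10 * f2 (log_radius x) + 9 * f (log_radius x))).
Proof.
move=> Uf.
pose h t := expR (- t) * f t.
pose h1 t := expR (- t) * (f1 t - f t).
pose h2 t := expR (- t) * (f2 t - 2 * f1 t + f t).
have Dh (t : R) : is_derive t 1 h (h1 t) by rewrite /h /h1; der; ring.
have Dh1 (t : R) : is_derive t 1 h1 (h2 t) by rewrite /h1 /h2; der; ring.
have L1 := laplacian_coord_radial Dh Dh1 Uf.
pose k t := expR (- (3 * t)) * (f2 t + 2 * f1 t - 3 * f t).
pose k1 t := expR (- (3 * t)) * (f3 t - f2 t - 9 * f1 t + 9 * f t).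
pose k2 t := expR (- (3 * t)) * (f4 t - 4 * f3 t - 6 * f2 t + 36 * f1 t - 27 * f t).
have Dk (t : R) : is_derive t 1 k (k1 t) by rewrite /k /k1; der; ring.
have Dk1 (t : R) : is_derive t 1 k1 (k2 t) by rewrite /k1 /k2; der; ring.
have {}L1 x : x != 0 -> laplacian U x = x 0 j * k (log_radius x).
  move=> /L1 ->; rewrite /h1 /h2 /k -(expR_mul2 _ 2 1) mul1r; ring.
move=> x x0; rewrite (laplacian_coord_radial Dk Dk1 L1 x0) -(expR_mul2 _ 2 3) /k1 /k2.
by ring.
Qed.

End Bilaplacian.

(** * The equivariant biharmonic map equation *)

Section Equivariant.
Local Open Scope classical_set_scope.
Local Open Scope ring_scope.
Context {R : realType}.
Variable psi : R -> R.
Local Notation u := (Upsilon psi).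

Lemma dotC n (v w : 'rV[R]_n) : dot v w = dot w v.
Proof. by apply: eq_bigr => i _; rewrite mulrC. Qed.

Lemma enorm_log_radius (x : 'rV[R]_4) : x != 0 -> enorm x = expR (log_radius x).
Proof.
by move=> x0; rewrite /enorm -expR_log_radius // sqrtr_sqr ger0_norm ?expR_ge0.
Qed.

Lemma Upsilon_coord (i : 'I_4) (x : 'rV[R]_4) : x != 0 ->
  component u (lshift 1 i) x =
  x 0 i * (expR (- log_radius x) * sin (psi (expR (log_radius x)))).
Proof.
move=> x0; rewrite /component /Upsilon (negbTE x0) (row_mxEl _ _ 0 i) !mxE.
by rewrite enorm_log_radius // expRN; ring.
Qed.

Lemma Upsilon_last (x : 'rV[R]_4) : x != 0 ->
  component u (rshift 4 ord0) x = cos (psi (expR (log_radius x))).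
Proof.
move=> x0; rewrite /component /Upsilon (negbTE x0) (@row_mxEr R 1 4 1) !mxE.
by rewrite enorm_log_radius.
Qed.

(** The bilaplacian is tested at one point of radius [e^t] against the tangent vector along the
    meridian. The families [f] and [g] are the successive derivatives of [sin y] and [cos y]. *)
Lemma biharmonic_polar_ode (y y1 y2 y3 y4 : R -> R) :
  (forall t : R, is_derive t 1 y (y1 t)) -> (forall t : R, is_derive t 1 y1 (y2 t)) ->
  (forall t : R, is_derive t 1 y2 (y3 t)) -> (forall t : R, is_derive t 1 y3 (y4 t)) ->
  (forall t, y t = psi (expR t)) -> biharmonic u ->
  forall t, polar_ode (y t) (y1 t) (y2 t) (y4 t).
Proof.
move=> D0 D1 D2 D3 yE [_ bih] t.
pose f t := sin (y t).
pose f1 t := cos (y t) * y1 t.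
pose f2 t := cos (y t) * y2 t - sin (y t) * y1 t ^+ 2.
pose f3 t := cos (y t) * y3 t - 3 * sin (y t) * y1 t * y2 t - cos (y t) * y1 t ^+ 3.
pose f4 t := cos (y t) * y4 t - 4 * sin (y t) * y1 t * y3 t - 3 * sin (y t) * y2 t ^+ 2
  - 6 * cos (y t) * y1 t ^+ 2 * y2 t + sin (y t) * y1 t ^+ 4.
have F0 (s : R) : is_derive s 1 f (f1 s) by rewrite /f /f1; der; rewrite /f /f1 /f2; ring.
have F1 (s : R) : is_derive s 1 f1 (f2 s) by rewrite /f1 /f2; der; rewrite /f /f1 /f2; ring.
have F2 (s : R) : is_derive s 1 f2 (f3 s) by rewrite /f2 /f3; der; rewrite /f /f1 /f2; ring.
have F3 (s : R) : is_derive s 1 f3 (f4 s) by rewrite /f3 /f4; der; rewrite /f /f1 /f2; ring.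
pose g t := cos (y t).
pose g1 t := - sin (y t) * y1 t.
pose g2 t := - sin (y t) * y2 t - cos (y t) * y1 t ^+ 2.
pose g3 t := - sin (y t) * y3 t - 3 * cos (y t) * y1 t * y2 t + sin (y t) * y1 t ^+ 3.
pose g4 t := - sin (y t) * y4 t - 4 * cos (y t) * y1 t * y3 t - 3 * cos (y t) * y2 t ^+ 2
  + 6 * sin (y t) * y1 t ^+ 2 * y2 t + cos (y t) * y1 t ^+ 4.
have G0 (s : R) : is_derive s 1 g (g1 s) by rewrite /g /g1; der; rewrite /f /f1 /g /g1 /g2; ring.
have G1 (s : R) : is_derive s 1 g1 (g2 s) by rewrite /g1 /g2; der; rewrite /f /f1 /g /g1 /g2; ring.
have G2 (s : R) : is_derive s 1 g2 (g3 s) by rewrite /g2 /g3; der; rewrite /f /f1 /g /g1 /g2; ring.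
have G3 (s : R) : is_derive s 1 g3 (g4 s) by rewrite /g3 /g4; der; rewrite /f /f1 /g /g1 /g2; ring.
have Uf x : x != 0 -> component u (lshift 1 (0 : 'I_4)) x =
    x 0 0 * (expR (- log_radius x) * f (log_radius x)).
  by move=> x0; rewrite Upsilon_coord // /f yE.
have Ug x : x != 0 -> component u (rshift 4 ord0) x = g (log_radius x).
  by move=> x0; rewrite Upsilon_last // /g yE.
pose x : 'rV[R]_4 := expR t *: delta_mx 0 0.
have dotx : dot x x = expR t ^+ 2.
  rewrite /dot (bigD1 0) //= big1 => [|i /negPf i0]; rewrite !mxE.
    by rewrite eqxx /= mulr1 addr0.
  by rewrite i0 andbF mulr0 mul0r.
have x0 : x != 0.
  apply/eqP => /(congr1 (fun z : 'rV[R]_4 => dot z z)); rewrite dotx => /eqP.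
  rewrite [X in _ == X]big1 => [|i _]; last by rewrite mxE mul0r.
  by rewrite sqrf_eq0 gt_eqF ?expR_gt0.
have rx : log_radius x = t.
  by rewrite /log_radius dotx -expRM_natl expRK mulrC mulKf ?pnatr_eq0.
have x00 : x 0 0 = expR t by rewrite !mxE eqxx /= mulr1.
(* The derivative of the profile [(sin y, cos y)] with respect to [y]. *)
pose v : 'rV[R]_5 :=
  row_mx (cos (y t) *: delta_mx 0 0 : 'rV_4) (const_mx (- sin (y t)) : 'rV_1).
have dotv (w : 'rV[R]_5) : dot w v =
    w 0 (lshift 1 (0 : 'I_4)) * cos (y t) - w 0 (rshift 4 ord0) * sin (y t).
  rewrite /dot (@big_split_ord _ _ _ 4 1) big_ord1 /= (bigD1 0) //=.
  rewrite /v (@row_mxEl R 1 4 1 _ _ 0 0) (@row_mxEr R 1 4 1) !mxE big1 => [|i /negPf i0].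
    by rewrite eqxx /=; ring.
  by rewrite (@row_mxEl R 1 4 1) !mxE i0 andbF !mulr0.
have tv : tangent_sphere (u x) v.
  rewrite /tangent_sphere /= dotC dotv -/(component u _ x) -/(component u (rshift 4 ord0) x).
  by rewrite Uf // Ug // rx x00 /f /g mulrA -expRD subrr expR0; ring.
have := bih x v tv; rewrite dotv !mxE.
have cE j : component (laplacian_map u) j = laplacian (component u j).
  by apply/funext => z; rewrite /component mxE.
rewrite (etrans (congr1 (laplacian^~ x) (cE (lshift 1 (0 : 'I_4))))
  (bilaplacian_coord_radial F0 F1 F2 F3 Uf x0)).
rewrite (etrans (congr1 (laplacian^~ x) (cE (rshift 4 ord0)))
  (bilaplacian_radial G0 G1 G2 G3 Ug x0)) rx x00.
have -> : expR (- (5 * t)) = expR (- (4 * t)) * expR (- t) by rewrite -expRD; congr expR; ring.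
have Et : expR t * expR (- t) = 1 by rewrite -expRD subrr expR0.
have e0 := expR_gt0 (- (4 * t)).
have -> : expR t * (expR (- (4 * t)) * expR (- t) * (f4 t - 10 * f2 t + 9 * f t))
    * cos (y t) - expR (- (4 * t)) * (g4 t - 4 * g2 t) * sin (y t) =
  expR (- (4 * t)) * (cos (y t) * (f4 t - 10 * f2 t + 9 * f t)
    - sin (y t) * (g4 t - 4 * g2 t)) by ring: Et.
(* After removal of [expR (- (4 * t))], the identity [cos^2 = 1 - sin^2] reduces the bracket to [y4]
   minus the right-hand side of [polar_ode]. *)
move/eqP; rewrite mulf_eq0 gt_eqF //= /f4 /f2 /f /g4 /g2 => /eqP E.
have C2 := cos2sin2 (y t); apply/eqP; rewrite -subr_eq0 -E; apply/eqP.
ring: C2.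
Qed.

End Equivariant.

(** * Conclusion for equivariant biharmonic maps *)

Lemma Upsilon0 (R : realType) (psi : R -> R) : (forall r, 0 <= r -> psi r = 0) ->
  forall x, Upsilon psi x = delta_mx 0 ord_max.
Proof.
move=> psi_0 x; rewrite /Upsilon; case: eqP => // _.
rewrite psi_0 ?sqrtr_ge0 // sin0 cos0 scale0r; apply/rowP => j.
have -> : (ord_max : 'I_5) = rshift 4 (ord0 : 'I_1) by apply: val_inj.
rewrite [RHS]mxE eqxx /=; case: (@split_ordP 4 1 j) => i ->.
  by rewrite (@row_mxEl R 1 4 1) mxE (@eq_lrshift 4 1).
by rewrite (@row_mxEr R 1 4 1) mxE ord1 eqxx.
Qed.

Theorem theorem1p6 (R : realType) (psi : R -> R)
    (psi_smooth : smooth_half_line psi)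
    (psi0 : psi 0 = 0)
    (u_biharmonic : biharmonic (Upsilon psi))
    (u_nonconstant : ~ exists c : 'rV[R]_5, forall x, Upsilon psi x = c) :
  exists lambda eps : R, 0 < lambda /\ (eps = 1 \/ eps = -1) /\
    forall r : R, 0 <= r -> psi r = 2 * eps * atan (lambda * r).
Proof.
pose p := polar (jet psi).
have p_der k : (k < 4)%N -> forall t : R, is_derive t 1 (p k) (p k.+1 t).
  by move=> k4 t; apply: polar_der k4; exact: jet_expR_der.
(* All these limits equal the derivative of [psi] at 0; [psi 0 = 0] provides the case [k = 0]. *)
have p_lim k : (k < 4)%N -> (p k t * expR (- t) @[t --> -oo] --> jet psi 1 0)%classic.
  apply: polar_ninfty; last exact: jet_ninfty.
  have := jet_quotient_ninfty psi_smooth (k := 0); rewrite [jet psi 0 0]psi0.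
  by under eq_fun do rewrite subr0.
have ode : forall t, polar_ode (p 0%N t) (p 1%N t) (p 2%N t) (p 4%N t).
  by apply: (biharmonic_polar_ode (p_der 0%N isT) (p_der 1%N isT) (p_der 2%N isT) (p_der 3%N isT)).
have p_lim0 k (k4 : (k < 4)%N) : (p k t @[t --> -oo] --> (0 : R))%classic.
  exact: cvg0_of_expR (p_lim k k4).
have Z : zero_energy (p 0%N) (p 1%N) (p 2%N) (p 3%N).
  apply: (zero_energy_of_ode (p_der 0%N isT) (p_der 1%N isT) (p_der 2%N isT)
    (p_der 3%N isT) ode); exact: p_lim0.
have [l hl] := entire_solution Z (p_der 3%N isT) ode
  (p_lim 0%N isT) (p_lim 1%N isT) (p_lim 2%N isT).
have {hl} psiE r : 0 <= r -> psi r = 2 * atan (l * r).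
  rewrite le_eqVlt => /orP[/eqP <-|r0]; first by rewrite psi0 mulr0 atan0 mulr0.
  by have := hl (ln r); rewrite /p /polar /= lnK // posrE.
have l0 : l != 0.
  apply/eqP => l0; apply: u_nonconstant; exists (delta_mx 0 ord_max).
  by apply: Upsilon0 => r /psiE ->; rewrite l0 mul0r atan0 mulr0.
(* As [atan] is odd, the sign of [l] moves outside and the dilation factor is its absolute value. *)
exists `|l|, (Num.sg l); split; first by rewrite normr_gt0.
split; first by case: sgrP l0 => // _ _; [left | right].
move=> r /psiE ->; rewrite -mulrA; congr (2 * _).
rewrite {1}(numEsg l); case: sgrP l0 => // _ _; rewrite ?mul1r //.
by rewrite !mulN1r mulNr atanN.
Qed.
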